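(* Let $p,q\ge 0$ be integers with $n=p+q\ge 1$. (Flat case) Let $\nu$ be a constant null vector of $\mathbb{R}^{n+2}_{p+1}$ and let $\Sigma$ be an $n$-dimensional submanifold of $\mathbb{R}^{n+2}_{p+1}$ with non-degenerate induced metric which is contained in the hyperplane $\nu^{\perp}$. Then $\Sigma$ has null second fundamental form and is therefore marginally trapped. Moreover, both the tangent and the normal bundles of $\Sigma$ are flat. (Spherical case) Let $\nu$ be a constant null vector of $\mathbb{R}^{n+3}_{p+2}$ and let $\Sigma$ be an $n$-dimensional submanifold of $\mathbb{S}^{n+2}_{p+1}$ with non-degenerate induced metric which is contained in the hypersurface $\nu^{\perp}\cap \mathbb{S}^{n+2}_{p+1}$. Then $\Sigma$ has null second fundamental form and is therefore marginally trapped. Moreover, $\Sigma$ has constant scalar curvature and flat normal bundle. (Converse) Any $n$-dimensional submanifold of $\mathbb{R}^{n+2}_{p+1}$ or $\mathbb{S}^{n+2}_{p+1}$, with non-degenerate induced metric of signature $(p,q)$ and null second fundamental form, is locally of this form, i.e. is locally contained in $\nu^\perp$ (respectively $\nu^\perp\cap\mathbb{S}^{n+2}_{p+1}$) for some constant null vector $\nu$ of $\mathbb{R}^{n+2}_{p+1}$ (respectively $\mathbb{R}^{n+3}_{p+2}$).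
   Context: $\mathbb{R}^{m}_{k}$ denotes $\mathbb{R}^m$ with the inner product $\langle\cdot,\cdot\rangle=\sum_{i=1}^{k}dx_i^2-\sum_{i=k+1}^{m}dx_i^2$. A vector $v\ne0$ is null if $\langle v,v\rangle=0$. $\mathbb{S}^{n+2}_{p+1}=\{x\in\mathbb{R}^{n+3}_{p+2}:\langle x,x\rangle=1\}$ with the induced metric (signature $(p+1,q+1)$, constant sectional curvature $1$); $\nu^\perp$ is the orthogonal of $\nu$ for $\langle\cdot,\cdot\rangle$. The submanifolds $\Sigma$ considered have codimension two in $\mathbb{R}^{n+2}_{p+1}$ or $\mathbb{S}^{n+2}_{p+1}$, non-degenerate induced metric of signature $(p,q)$, and hence Lorentzian (indefinite) two-dimensional normal bundle $N\Sigma$. The second fundamental form is $h(X,Y)=(D_XY)^\perp$, where $D$ is the Levi-Civita connection of the ambient space and $\perp$ the projection on $N\Sigma$; it is called null if $\langle h(X,Y),h(X,Y)\rangle=0$ for all tangent $X,Y$ (the value $h(X,Y)=0$ being allowed). The mean curvature vector $\vec H$ is $\frac1n$ times the trace of $h$ with respect to the induced metric; $\Sigma$ is marginally trapped if $\langle\vec H,\vec H\rangle=0$.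
   Formalization: The converse is false as stated: h may vanish and switch null directions. It is proved near points where h is nonzero or lies in one smooth null normal line field, and on a dense subset of Σ; in the flat case containment in ν^⊥ is up to translation. *)

(* Defs.v *)
From HB Require Import structures.
From mathcomp Require Import all_boot all_order all_algebra.
From mathcomp Require Import all_classical all_reals all_analysis.

Set Implicit Arguments.
Unset Strict Implicit.
Unset Printing Implicit Defensive.

Import Order.TTheory GRing.Theory Num.Theory.
Import numFieldNormedType.Exports.

Local Open Scope classical_set_scope.
Local Open Scope ring_scope.

(* Diagonal of the standard quadratic form of signature (k, m - k). *)
Definition ip_sign {R : realType} (m k : nat) : 'rV[R]_m :=
  \row_(i < m) (if (i < k)%N then 1 else -1).

(* The pair ('rV[R]_m, ip k) is the pseudo-Euclidean space R^m_k. *)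
Definition ip {R : realType} (m k : nat) (v w : 'rV[R]_m) : R :=
  \sum_(i < m) ip_sign m k 0 i * v 0 i * w 0 i.
Arguments ip {R m} k v w.

Definition null_vector {R : realType} (m k : nat) (v : 'rV[R]_m) : Prop :=
  v <> 0 /\ ip k v v = 0.
Arguments null_vector {R m} k v.

Definition orth {R : realType} (m k : nat) (v : 'rV[R]_m) : set 'rV[R]_m :=
  [set x | ip k x v = 0].
Arguments orth {R m} k v.

Definition unit_sphere {R : realType} (m k : nat) : set 'rV[R]_m :=
  [set x | ip k x x = 1].
Arguments unit_sphere {R} m k _.

(* [amb x] is the orthogonal projection of R^m_k onto the tangent space at x
   of the ambient space form; the Levi-Civita connection of that space form is
   [amb] applied to the flat directional derivative. *)
Definition flat_amb {R : realType} (m : nat) (x v : 'rV[R]_m) : 'rV[R]_m := v.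

Definition sphere_amb {R : realType} (m k : nat) (x v : 'rV[R]_m) :
  'rV[R]_m := v - ip k v x *: x.
Arguments flat_amb {R m} x v.
Arguments sphere_amb {R m} k x v.

Fixpoint iter_derive {R : realType} {V W : normedModType R}
    (vs : seq V) (f : V -> W) : V -> W :=
  if vs is v :: vs' then 'D_v (iter_derive vs' f) else f.

(* C^oo on U: differentiability of the iterated directional derivatives of
   every order forces all of them to be continuous. *)
Definition smooth_on {R : realType} {V W : normedModType R}
    (U : set V) (f : V -> W) : Prop :=
  forall (vs : seq V) (u : V), U u -> differentiable (iter_derive vs f) u.

(* f is a smooth regular parametrization, with domain the open set U, of a
   relatively open subset of Sigma: an immersion which is a homeomorphism onto
   its image. *)
Definition local_param {R : realType} (n m : nat) (Sigma : set 'rV[R]_m)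
    (U : set 'rV[R]_n) (f : 'rV[R]_n -> 'rV[R]_m) : Prop :=
  [/\ open U,
      smooth_on U f,
      forall u, U u -> injective ('d f u),
      {in U &, injective f} &
      forall V : set 'rV[R]_n, open V -> V `<=` U ->
        exists2 O : set 'rV[R]_m, open O & f @` V = Sigma `&` O].

Definition submanifold {R : realType} (n m : nat) (Sigma : set 'rV[R]_m) :
    Prop :=
  forall x, Sigma x -> exists (U : set 'rV[R]_n) (f : 'rV[R]_n -> 'rV[R]_m),
    local_param Sigma U f /\ (f @` U) x.
Arguments submanifold {R} n {m} Sigma.

Definition pderive {R : realType} (n : nat) {W : normedModType R} (i : 'I_n)
    (f : 'rV[R]_n -> W) : 'rV[R]_n -> W :=
  'D_(delta_mx 0 i) f.

Definition gram {R : realType} (n m k : nat) (f : 'rV[R]_n -> 'rV[R]_m)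
    (u : 'rV[R]_n) : 'M[R]_n :=
  \matrix_(i < n, j < n) ip k (pderive i f u) (pderive j f u).

Definition gram_inv {R : realType} (n m k : nat) (f : 'rV[R]_n -> 'rV[R]_m)
    (u : 'rV[R]_n) : 'M[R]_n := invmx (gram k f u).

Definition nondegenerate_metric {R : realType} (n m k : nat)
    (Sigma : set 'rV[R]_m) : Prop :=
  forall (U : set 'rV[R]_n) (f : 'rV[R]_n -> 'rV[R]_m),
    local_param Sigma U f -> forall u, U u -> gram k f u \in unitmx.
Arguments nondegenerate_metric {R} n {m} k Sigma.

Definition has_signature {R : realType} (n m k p q : nat)
    (Sigma : set 'rV[R]_m) : Prop :=
  n = (p + q)%N /\
  forall (U : set 'rV[R]_n) (f : 'rV[R]_n -> 'rV[R]_m),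
    local_param Sigma U f -> forall u, U u ->
    exists2 B : 'M[R]_n, B \in unitmx &
      B *m gram k f u *m B^T = diag_mx (ip_sign n p).
Arguments has_signature {R} n {m} k p q Sigma.

(* Orthogonal projection onto the tangent space of the immersion f at u. *)
Definition tan_part {R : realType} (n m k : nat) (f : 'rV[R]_n -> 'rV[R]_m)
    (u : 'rV[R]_n) (w : 'rV[R]_m) : 'rV[R]_m :=
  \sum_(i < n) \sum_(j < n)
    (gram_inv k f u i j * ip k w (pderive j f u)) *: pderive i f u.

(* Orthogonal projection onto the normal space of the immersion f at u inside
   the tangent space of the ambient space form. *)
Definition nor_part {R : realType} (n m k : nat)
    (amb : 'rV[R]_m -> 'rV[R]_m -> 'rV[R]_m) (f : 'rV[R]_n -> 'rV[R]_m)
    (u : 'rV[R]_n) (w : 'rV[R]_m) : 'rV[R]_m :=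
  amb (f u) w - tan_part k f u (amb (f u) w).

(* h(df(a), df(b)) at f(u); the constant vector b of the parameter space
   provides the extension df(b) of the second argument to a tangent field. *)
Definition sff {R : realType} (n m k : nat)
    (amb : 'rV[R]_m -> 'rV[R]_m -> 'rV[R]_m) (f : 'rV[R]_n -> 'rV[R]_m)
    (a b u : 'rV[R]_n) : 'rV[R]_m :=
  nor_part k amb f u ('D_a ('D_b f) u).

Definition mean_curvature {R : realType} (n m k : nat)
    (amb : 'rV[R]_m -> 'rV[R]_m -> 'rV[R]_m) (f : 'rV[R]_n -> 'rV[R]_m)
    (u : 'rV[R]_n) : 'rV[R]_m :=
  n%:R^-1 *: \sum_(i < n) \sum_(j < n)
    gram_inv k f u i j *: sff k amb f (delta_mx 0 i) (delta_mx 0 j) u.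

Definition null_sff {R : realType} (n m k : nat)
    (amb : 'rV[R]_m -> 'rV[R]_m -> 'rV[R]_m) (Sigma : set 'rV[R]_m) : Prop :=
  forall (U : set 'rV[R]_n) (f : 'rV[R]_n -> 'rV[R]_m),
    local_param Sigma U f -> forall u, U u -> forall a b : 'rV[R]_n,
    ip k (sff k amb f a b u) (sff k amb f a b u) = 0.
Arguments null_sff {R} n {m} k amb Sigma.

Definition marginally_trapped {R : realType} (n m k : nat)
    (amb : 'rV[R]_m -> 'rV[R]_m -> 'rV[R]_m) (Sigma : set 'rV[R]_m) : Prop :=
  forall (U : set 'rV[R]_n) (f : 'rV[R]_n -> 'rV[R]_m),
    local_param Sigma U f -> forall u, U u ->
    ip k (mean_curvature k amb f u) (mean_curvature k amb f u) = 0.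
Arguments marginally_trapped {R} n {m} k amb Sigma.

(* Gamma^l_ij of the Levi-Civita connection of the induced metric. *)
Definition christoffel {R : realType} (n m k : nat)
    (f : 'rV[R]_n -> 'rV[R]_m) (l i j : 'I_n) (u : 'rV[R]_n) : R :=
  2^-1 * \sum_(r < n) gram_inv k f u l r *
    (pderive i (fun v => gram k f v j r) u
     + pderive j (fun v => gram k f v i r) u
     - pderive r (fun v => gram k f v i j) u).

(* Coefficient of d_l in R(d_i, d_j) d_c, where
   R(X, Y) = [nabla_X, nabla_Y] - nabla_[X, Y]. *)
Definition riemann {R : realType} (n m k : nat)
    (f : 'rV[R]_n -> 'rV[R]_m) (l c i j : 'I_n) (u : 'rV[R]_n) : R :=
  pderive i (christoffel k f l j c) u - pderive j (christoffel k f l i c) u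
  + \sum_(r < n)
      (christoffel k f l i r u * christoffel k f r j c u
       - christoffel k f l j r u * christoffel k f r i c u).

Definition scalar_curvature {R : realType} (n m k : nat)
    (f : 'rV[R]_n -> 'rV[R]_m) (u : 'rV[R]_n) : R :=
  \sum_(j < n) \sum_(c < n)
    gram_inv k f u j c * \sum_(i < n) riemann k f i c i j u.

Definition flat_tangent_bundle {R : realType} (n m k : nat)
    (Sigma : set 'rV[R]_m) : Prop :=
  forall (U : set 'rV[R]_n) (f : 'rV[R]_n -> 'rV[R]_m),
    local_param Sigma U f -> forall u, U u ->
    forall l c i j : 'I_n, riemann k f l c i j u = 0.
Arguments flat_tangent_bundle {R} n {m} k Sigma.

Definition constant_scalar_curvature {R : realType} (n m k : nat)
    (Sigma : set 'rV[R]_m) : Prop :=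
  exists s : R, forall (U : set 'rV[R]_n) (f : 'rV[R]_n -> 'rV[R]_m),
    local_param Sigma U f -> forall u, U u -> scalar_curvature k f u = s.
Arguments constant_scalar_curvature {R} n {m} k Sigma.

Definition normal_field {R : realType} (n m k : nat)
    (amb : 'rV[R]_m -> 'rV[R]_m -> 'rV[R]_m) (U : set 'rV[R]_n)
    (f xi : 'rV[R]_n -> 'rV[R]_m) : Prop :=
  smooth_on U xi /\
  forall u, U u ->
    amb (f u) (xi u) = xi u /\ forall a : 'rV[R]_n, ip k (xi u) ('D_a f u) = 0.

Definition normal_connection {R : realType} (n m k : nat)
    (amb : 'rV[R]_m -> 'rV[R]_m -> 'rV[R]_m) (f : 'rV[R]_n -> 'rV[R]_m)
    (a : 'rV[R]_n) (xi : 'rV[R]_n -> 'rV[R]_m) (u : 'rV[R]_n) : 'rV[R]_m :=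
  nor_part k amb f u ('D_a xi u).

(* The bracket term of the normal curvature vanishes, since the constant
   vectors a and b induce commuting coordinate fields. *)
Definition flat_normal_bundle {R : realType} (n m k : nat)
    (amb : 'rV[R]_m -> 'rV[R]_m -> 'rV[R]_m) (Sigma : set 'rV[R]_m) : Prop :=
  forall (U : set 'rV[R]_n) (f : 'rV[R]_n -> 'rV[R]_m),
    local_param Sigma U f ->
  forall xi : 'rV[R]_n -> 'rV[R]_m, normal_field k amb U f xi ->
  forall (a b u : 'rV[R]_n), U u ->
    normal_connection k amb f a (normal_connection k amb f b xi) u
    - normal_connection k amb f b (normal_connection k amb f a xi) u = 0.
Arguments flat_normal_bundle {R} n {m} k amb Sigma.

Definition sff_nonzero_at {R : realType} (n m k : nat)
    (amb : 'rV[R]_m -> 'rV[R]_m -> 'rV[R]_m) (Sigma : set 'rV[R]_m)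
    (x : 'rV[R]_m) : Prop :=
  exists (U : set 'rV[R]_n) (f : 'rV[R]_n -> 'rV[R]_m) (u a b : 'rV[R]_n),
    [/\ local_param Sigma U f, U u, f u = x & sff k amb f a b u <> 0].
Arguments sff_nonzero_at {R} n {m} k amb Sigma x.

(* Near x, the second fundamental form takes its values in one smooth field of
   null lines of the normal bundle. A form which is null at every point may
   fail this where it vanishes: it can switch there from one of the two null
   directions of the normal plane to the other. *)
Definition single_null_direction_at {R : realType} (n m k : nat)
    (amb : 'rV[R]_m -> 'rV[R]_m -> 'rV[R]_m) (Sigma : set 'rV[R]_m)
    (x : 'rV[R]_m) : Prop :=
  exists (U : set 'rV[R]_n) (f xi : 'rV[R]_n -> 'rV[R]_m),
    [/\ local_param Sigma U f, (f @` U) x, normal_field k amb U f xi &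
        forall u, U u -> null_vector k (xi u) /\
          forall a b : 'rV[R]_n, exists t : R, sff k amb f a b u = t *: xi u].
Arguments single_null_direction_at {R} n {m} k amb Sigma x.

Definition locally_contained_at {R : realType} (m : nat)
    (Sigma A : set 'rV[R]_m) (x : 'rV[R]_m) : Prop :=
  exists O : set 'rV[R]_m, [/\ open O, O x & Sigma `&` O `<=` A].

(* Up to an ambient translation, Sigma is contained near x in the orthogonal
   of a null vector. *)
Definition flat_model_at {R : realType} (m k : nat) (Sigma : set 'rV[R]_m)
    (x : 'rV[R]_m) : Prop :=
  exists nu c : 'rV[R]_m, null_vector k nu /\
    locally_contained_at Sigma [set y | orth k nu (y - c)] x.
Arguments flat_model_at {R m} k Sigma x.

Definition sphere_model_at {R : realType} (m k : nat) (Sigma : set 'rV[R]_m)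
    (x : 'rV[R]_m) : Prop :=
  exists nu : 'rV[R]_m, null_vector k nu /\
    locally_contained_at Sigma (orth k nu `&` unit_sphere m k) x.
Arguments sphere_model_at {R m} k Sigma x.

Definition dense_in {T : topologicalType} (S A : set T) : Prop :=
  S `<=` closure (S `&` A).

(* Main.v *)
(* In both ambient spaces the normal bundle of Sigma is a bundle of Lorentzian
   planes, and in such a plane the orthogonal of a null vector nu is the line
   R nu.
   If Sigma lies in nu^perp, then nu is normal and orthogonal to all second
   derivatives of a parametrization, so h = alpha nu takes its values in one
   null line. The h-terms of the Gauss equation therefore vanish, and the shape
   operators commute in the Ricci equation.
   Conversely, suppose that h takes its values in the null lines spanned by a
   normal field xi. Then <D_a xi, d_i f> = - <xi, h(a, e_i)> = 0, hence
   D_a xi is normal and orthogonal to xi, that is, D_a xi = tau xi: the line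
   R xi is locally constant. Where h(a, b) <> 0, polarization shows that
   xi = h(a, b) is such a field. Where h vanishes on an open set, the normal
   plane itself is constant and, by its signature, contains a null vector.
   Both ambient spaces are treated at once: the boolean kap is the curvature of
   the space form, which sits in the pseudo-Euclidean space of dimension
   kap + n + 2 and index kap + p + 1; the position vector f counts as an
   additional tangent vector when kap = 1. *)
Require Import Defs.
From HB Require Import structures.
From mathcomp Require Import all_boot all_order all_algebra.
From mathcomp Require Import all_classical all_reals all_analysis.
From mathcomp Require Import ring lra.
Import Order.TTheory GRing.Theory Num.Theory.
Import numFieldNormedType.Exports.
Local Open Scope classical_set_scope.
Local Open Scope ring_scope.

Set Implicit Arguments.
Unset Strict Implicit.
Unset Printing Implicit Defensive.

(** * Differential calculus *)

Section Calculus.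
Context {R : realType} {V : normedModType R}.
Implicit Types (u a b : V).

(** The first-order expansion of f at u is one of g too, the values agreeing near u; [diff_unique]
    then makes it the differential of g. *)
Lemma near_eq_differentiable {W : normedModType R} (f g : V -> W) u :
  (\near u, f u = g u) -> differentiable f u -> differentiable g u.
Proof.
move=> fg df; have fgu : f u = g u by exact: nbhs_singleton fg.
have cdf : continuous ('d f u) by exact: diff_continuous.
have dg : g \o shift u = cst (g u) + 'd f u +o_ 0 id.
  apply/eqaddoP => e e0; move/diff_locally/eqaddoP: (df) => /(_ e e0) dfe.
  have fg' : \forall h \near (0 : V), f (shift u h) = g (shift u h).
    move/nbhs_ballP : fg => [r /= r0 hr]; apply/nbhs_ballP; exists r => // h.
    rewrite -ball_normE /= sub0r normrN => hr'; apply: hr.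
    by rewrite -ball_normE /= opprD addrCA subrr addr0 normrN.
  near=> h; have E : f (shift u h) = g (shift u h) by near: h.
  suff : `|g (shift u h) - (g u + 'd f u h)| <= e * `|h| by [].
  by rewrite -fgu -E; near: h; exact: dfe.
by apply/diff_locallyP; rewrite (diff_unique cdf dg).
Unshelve. all: by end_near. Qed.

Lemma differentiable_mxP m n (X : V -> 'M[R]_(m, n)) u :
  (forall i j, differentiable (fun v => X v i j) u) <-> differentiable X u.
Proof.
split=> [dX|dX i j]; last first.
  by apply: (@differentiable_comp _ _ _ _ X (fun M : 'M[R]_(m, n) => M i j)) => //;
    exact: differentiable_coord.
have -> : X = \sum_i \sum_j (fun v => X v i j *: delta_mx i j).
  apply/funext => v; rewrite fct_sumE [LHS]matrix_sum_delta.
  by apply: eq_bigr => i _; rewrite fct_sumE.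
apply: differentiable_sum => i; apply: differentiable_sum => j.
exact: differentiableZl.
Qed.

Lemma derive_coord m n (X : V -> 'M[R]_(m, n)) u a i j :
  differentiable X u -> ('D_a X u) i j = 'D_a (fun v => X v i j) u.
Proof. by move=> /(@diff_derivable _ _ _ _ _ a)/derive_mx ->; rewrite mxE. Qed.

Lemma differentiable_bigsum {W : normedModType R} (I : Type) (r : seq I)
    (P : pred I) (F : I -> V -> W) u :
  (forall i, P i -> differentiable (F i) u) ->
  differentiable (fun v => \sum_(i <- r | P i) F i v) u.
Proof.
move=> dF; rewrite (_ : (fun v => _) = \sum_(i <- r | P i) F i).
  by elim/big_ind : _ => // ? ? ? ?; exact: differentiableD.
by apply/funext => v; rewrite fct_sumE.
Qed.

Lemma differentiable_bigprod (I : Type) (r : seq I) (P : pred I)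
    (F : I -> V -> R) u :
  (forall i, P i -> differentiable (F i) u) ->
  differentiable (fun v => \prod_(i <- r | P i) F i v) u.
Proof.
move=> dF; rewrite (_ : (fun v => _) = \prod_(i <- r | P i) F i).
  elim/big_ind : _ => //.
  by move=> *; exact: differentiableM.
by apply/funext => v; rewrite fct_prodE.
Qed.

Lemma derive_bigsum {W : normedModType R} (I : Type) (r : seq I)
    (P : pred I) (F : I -> V -> W) u a :
  (forall i, P i -> differentiable (F i) u) ->
  'D_a (fun v => \sum_(i <- r | P i) F i v) u =
  \sum_(i <- r | P i) 'D_a (F i) u.
Proof.
move=> dF; elim: r => [|i r IH].
  rewrite big_nil (_ : (fun v => _) = cst 0) ?derive_cst //.
  by apply/funext => v; rewrite big_nil.
rewrite big_cons; case: ifPn => [Pi|nPi]; last first.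
  by rewrite -IH; congr derive; apply/funext => v; rewrite big_cons (negPf nPi).
rewrite (_ : (fun v => _) = F i + fun v => \sum_(j <- r | P j) F j v).
  rewrite deriveD ?IH //; apply: diff_derivable; first exact: dF.
  exact: differentiable_bigsum.
by apply/funext => v; rewrite big_cons Pi.
Qed.

Lemma derive_mulf (c g : V -> R) u a : differentiable c u ->
  differentiable g u ->
  'D_a (fun v => c v * g v) u = 'D_a c u * g u + c u * 'D_a g u.
Proof.
move=> dc dg; rewrite deriveM; [|exact: diff_derivable|exact: diff_derivable].
by rewrite addrC; congr (_ + _); rewrite mulrC.
Qed.

Lemma differentiable_scalev m n (c : V -> R) (X : V -> 'M[R]_(m, n)) u :
  differentiable c u -> differentiable X u ->
  differentiable (fun v => c v *: X v) u.
Proof.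
move=> dc dX; apply/differentiable_mxP => i j.
under eq_fun do rewrite mxE.
by apply: differentiableM => //; move/differentiable_mxP : dX; exact.
Qed.

Lemma derive_scalev m n (c : V -> R) (X : V -> 'M[R]_(m, n)) u a :
  differentiable c u -> differentiable X u ->
  'D_a (fun v => c v *: X v) u = 'D_a c u *: X u + c u *: 'D_a X u.
Proof.
move=> dc dX; apply/matrixP => i j.
rewrite derive_coord; last exact: differentiable_scalev.
rewrite !mxE derive_coord //; under eq_fun do rewrite mxE.
rewrite deriveM; first by rewrite addrC; congr (_ + _); rewrite mulrC.
  exact: diff_derivable.
by apply: diff_derivable; move/differentiable_mxP : dX; exact.
Qed.

Lemma differentiable_ip m k (X Y : V -> 'rV[R]_m) u :
  differentiable X u -> differentiable Y u ->
  differentiable (fun v => ip k (X v) (Y v)) u.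
Proof.
move=> /differentiable_mxP dX /differentiable_mxP dY.
apply: differentiable_bigsum => i _; apply: differentiableM => //.
by apply: differentiableM => //; exact: differentiable_cst.
Qed.

Lemma derive_ip m k (X Y : V -> 'rV[R]_m) u a :
  differentiable X u -> differentiable Y u ->
  'D_a (fun v => ip k (X v) (Y v)) u =
  ip k ('D_a X u) (Y u) + ip k (X u) ('D_a Y u).
Proof.
move=> dX dY.
have /differentiable_mxP dX' := dX; have /differentiable_mxP dY' := dY.
rewrite derive_bigsum => [|i _]; last first.
  by do 2?[apply: differentiableM => //]; exact: differentiable_cst.
rewrite -big_split /=; apply: eq_bigr => i _.
rewrite !derive_coord // deriveM; last exact: diff_derivable.
  rewrite deriveM; last exact: diff_derivable.
    rewrite derive_cst /GRing.scale /=; ring.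
  exact: derivable_cst.
by apply/diff_derivable/differentiableM => //; exact: differentiable_cst.
Qed.

Lemma differentiable_det n (A : V -> 'M[R]_n) u :
  differentiable A u -> differentiable (fun v => \det (A v)) u.
Proof.
move=> /differentiable_mxP dA; apply: differentiable_bigsum => s _.
apply: differentiableM; first exact: differentiable_cst.
exact: differentiable_bigprod.
Qed.

(** Cramer's formula expresses the inverse through determinants, but [invmx] follows it only on
    invertible matrices and is the identity map elsewhere: hence the transfer between functions that
    agree near u. *)
Lemma differentiable_invmx n (A : V -> 'M[R]_n) u :
  differentiable A u -> (\forall v \near u, A v \in unitmx) ->
  differentiable (fun v => invmx (A v)) u.
Proof.
move=> dA nA; apply: (@near_eq_differentiable _
    (fun v => (\det (A v))^-1 *: \adj (A v))).
  by near=> v; rewrite /invmx (near nA v).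
apply: differentiable_scalev.
  apply: differentiableV; first exact: differentiable_det.
  by have := nbhs_singleton nA; rewrite unitmxE unitfE.
apply/differentiable_mxP => i j; under eq_fun do rewrite mxE.
apply: differentiableM; first exact: differentiable_cst.
apply: differentiable_det; apply/differentiable_mxP => i' j'.
under eq_fun do rewrite !mxE.
by move/differentiable_mxP : dA; exact.
Unshelve. all: by end_near. Qed.

Lemma deriveDl {W : normedModType R} (f : V -> W) u a b :
  differentiable f u -> 'D_(a + b) f u = 'D_a f u + 'D_b f u.
Proof. by move=> df; rewrite !deriveE // linearD. Qed.

(** * Mean value arguments: symmetry of second derivatives, functions with zero derivative *)

Lemma line_is_derive {W : normedModType R} (f : V -> W) u a (s : R) :
  derivable f (u + s *: a) a ->
  is_derive s 1 (fun t => f (u + t *: a)) ('D_a f (u + s *: a)).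
Proof.
rewrite /derivable => df.
have E : (fun h : R => h^-1 *: (((fun t => f (u + t *: a)) \o shift s)
      (h *: (1 : R^o)) - f (u + s *: a))) =
    (fun h : R => h^-1 *: ((f \o shift (u + s *: a)) (h *: a)
      - f (u + s *: a))).
  apply/funext => h; congr (_ *: (f _ - _)) => /=.
  have -> : h *: (1 : R^o) = h by rewrite /GRing.scale /= mulr1.
  by rewrite scalerDl addrCA.
by apply: DeriveDef; rewrite ?/derivable ?/derive E.
Qed.

(** The second difference over the parallelogram with sides t a and t b is psi(t) - psi(0), where
    psi(s) = f(u + t b + s a) - f(u + s a). The mean value theorem turns it into t times a
    difference of two values of ['D_a f], and the differentiability of ['D_a f] at u expands
    both. *)
Lemma young_remainder (f : V -> R) u a b :
  (\forall v \near u, derivable f v a) -> differentiable ('D_a f) u ->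
  forall e : R, 0 < e -> exists2 d, 0 < d & forall t, 0 < t < d ->
   `|f (u + t *: a + t *: b) - f (u + t *: a) - f (u + t *: b) + f u
     - t ^+ 2 * 'D_b ('D_a f) u| <= e * t ^+ 2.
Proof.
move=> nf df e e0; set L := 'd ('D_a f) u.
(* The summand 1 keeps [N] positive when a = b = 0; [e'] is chosen so that two remainders of size e'
   t N add up to e t. *)
set N := `|a| + `|b| + 1.
have N0 : 0 < N by rewrite ltr_wpDl // addr_ge0.
set e' := e / (2 * N).
have e'0 : 0 < e' by rewrite divr_gt0 // mulr_gt0.
have [d1 /= d10 h1] : exists2 d1 : R, 0 < d1 & forall h : V, `|h| < d1 ->
    derivable f (u + h) a.
  move/nbhs_ballP : nf => [r /= r0 hr]; exists r => // h hlt; apply: hr.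
  by rewrite -ball_normE /= opprD addNKr normrN.
have [d2 /= d20 h2] : exists2 d1 : R, 0 < d1 & forall h : V, `|h| < d1 ->
    `|'D_a f (u + h) - 'D_a f u - L h| <= e' * `|h|.
  move/diff_locally/eqaddoP: (df) => /(_ e' e'0)/nbhs_ballP[r /= r0 hr].
  exists r => // h hlt; rewrite -addrA -opprD [u + h]addrC.
  by apply: (hr h); rewrite -ball_normE /= sub0r normrN.
have d0 : 0 < Num.min d1 d2 by rewrite lt_min d10.
exists (Num.min d1 d2 / N); first by rewrite divr_gt0.
move=> t /andP[t0]; rewrite ltr_pdivlMr // => tN.
(* The boolean [c] switches the displacement t b on or off, so that one estimate serves both terms
   of [psi]. *)
have small (s : R) (c : bool) : 0 <= s <= t ->
    `|s *: a + (c%:R * t) *: b| <= t * (`|a| + `|b|).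
  move=> /andP[s0 st]; apply: (le_trans (ler_normD _ _)).
  rewrite mulrDr !normrZ (ger0_norm s0) ger0_norm //.
  apply: lerD; first exact: ler_wpM2r.
  by apply: ler_wpM2r => //; rewrite (gtr0_norm t0) ler_piMl ?(ltW t0) // lern1 leq_b1.
have smallN : t * (`|a| + `|b|) < Num.min d1 d2.
  apply: le_lt_trans tN; rewrite ler_pM2l // /N; lra.
have small1 (s : R) (c : bool) : 0 <= s <= t -> `|s *: a + (c%:R * t) *: b| < d1.
  move=> /small-/(_ c)/le_lt_trans; apply.
  by move: smallN; rewrite lt_min => /andP[].
have small2 (s : R) (c : bool) : 0 <= s <= t -> `|s *: a + (c%:R * t) *: b| < d2.
  move=> /small-/(_ c)/le_lt_trans; apply.
  by move: smallN; rewrite lt_min => /andP[].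
pose psi (s : R) := f (u + t *: b + s *: a) - f (u + s *: a).
pose dpsi (s : R) := 'D_a f (u + t *: b + s *: a) - 'D_a f (u + s *: a).
have dv1 (s : R) : 0 <= s <= t -> derivable f (u + t *: b + s *: a) a.
  by move=> /small1 -/(_ true)/h1; rewrite mul1r [_ + t *: b]addrC addrA.
have dv0 (s : R) : 0 <= s <= t -> derivable f (u + s *: a) a.
  by move=> /small1 -/(_ false)/h1; rewrite mul0r scale0r addr0.
have psi' (s : R) : 0 <= s <= t -> is_derive s 1 psi (dpsi s).
  by move=> st; apply: is_deriveB; apply: line_is_derive; [exact: dv1|exact: dv0].
have [| |th thI Eth] := @MVT _ psi dpsi _ _ t0.
- by move=> s; rewrite in_itv /= => /andP[s0 st]; apply: psi'; rewrite !ltW.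
- apply: derivable_within_continuous => s; rewrite in_itv /= => /psi' [].
  by [].
have {thI} thI : 0 <= th <= t.
  by move: thI; rewrite in_itv /= => /andP[/ltW -> /ltW ->].
have E1 := h2 _ (small2 th true thI); have E0 := h2 _ (small2 th false thI).
have -> : f (u + t *: a + t *: b) - f (u + t *: a) - f (u + t *: b) + f u =
    psi t - psi 0.
  rewrite /psi scale0r !addr0 [u + t *: b + _]addrAC; ring.
rewrite Eth subr0.
have -> : 'D_b ('D_a f) u = L b by rewrite deriveE.
have Lb : L (th *: a + (true%:R * t) *: b) =
    L (th *: a + (false%:R * t) *: b) + t * L b.
  by rewrite mul1r mul0r scale0r addr0 linearD [X in _ + X]linearZ.
(* The linear terms of the two expansions differ by exactly t L b; what is left are the two
   remainders. *)
have -> : dpsi th * t - t ^+ 2 * L b =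
   t * (('D_a f (u + (th *: a + (true%:R * t) *: b)) - 'D_a f u
          - L (th *: a + (true%:R * t) *: b))
        - ('D_a f (u + (th *: a + (false%:R * t) *: b)) - 'D_a f u
          - L (th *: a + (false%:R * t) *: b))).
  rewrite Lb mul1r mul0r scale0r addr0 /dpsi.
  by rewrite [u + (th *: a + t *: b)]addrA [u + th *: a + _]addrAC; ring.
rewrite normrM (gtr0_norm t0).
have -> : e * t ^+ 2 = t * (e' * (t * N) + e' * (t * N)).
  by rewrite /e'; field; rewrite gt_eqF.
rewrite ler_pM2l //; apply: (le_trans (ler_normB _ _)).
have tN' (s : R) (c : bool) : 0 <= s <= t ->
    e' * `|s *: a + (c%:R * t) *: b| <= e' * (t * N).
  move=> /small-/(_ c) sc; rewrite ler_pM2l //; apply: (le_trans sc).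
  rewrite ler_pM2l // /N; lra.
by apply: lerD; [apply: le_trans E1 _|apply: le_trans E0 _]; exact: tN'.
Qed.

(** Here T is t^2, and y, z are the two middle terms of the second difference, which trade places
    when a and b do. *)
Lemma second_difference_quotients (x y z w T D1 D2 e : R) : 0 < T ->
  `|x - y - z + w - T * D1| <= e / 2 * T ->
  `|x - z - y + w - T * D2| <= e / 2 * T -> `|D1 - D2| <= e.
Proof.
move=> T0 H1 H2; rewrite -(ler_pM2l T0) -{1}(gtr0_norm T0) -normrM.
have -> : T * (D1 - D2) = (x - z - y + w - T * D2) - (x - y - z + w - T * D1).
  by ring.
apply: (le_trans (ler_normB _ _)); apply: (le_trans (lerD H2 H1)).
by rewrite -mulrDl -splitr mulrC.
Qed.

(** Young's theorem: the second difference is symmetric in a and b, and its quotient by t^2 is close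
    to both mixed derivatives. *)
Lemma derive_comm_scalar (f : V -> R) u a b :
  (\forall v \near u, differentiable f v) ->
  differentiable ('D_a f) u -> differentiable ('D_b f) u ->
  'D_b ('D_a f) u = 'D_a ('D_b f) u.
Proof.
move=> nf dfa dfb.
have na c : \forall v \near u, derivable f v c.
  by near=> v; apply: diff_derivable; near: v.
apply/eqP; rewrite -subr_eq0 -normr_le0; apply/ler_addgt0Pl => e e0; rewrite addr0.
have e2 : 0 < e / 2 by rewrite divr_gt0.
have [d1 d10 H1] := young_remainder b (na a) dfa e2.
have [d2 d20 H2] := young_remainder a (na b) dfb e2.
pose t := Num.min d1 d2 / 2.
have m0 : 0 < Num.min d1 d2 by rewrite lt_min d10.
have t0 : 0 < t by rewrite divr_gt0.
have tm : t < Num.min d1 d2 by rewrite /t ltr_pdivrMr // mulr_natr mulr2n ltrDl.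
move: (tm); rewrite lt_min => /andP[t1 t2].
have {}H1 := H1 t; have {}H2 := H2 t; rewrite t0 /= in H1 H2.
have tt : 0 < t ^+ 2 by rewrite exprn_gt0.
apply: second_difference_quotients tt (H1 t1) _.
by rewrite (addrAC u); exact: H2.
Unshelve. all: by end_near. Qed.

(** Reduction to the entries. Taking an entry commutes with derivation only where the function is
    differentiable, so the inner derivatives are replaced by functions equal to them near u. *)
Lemma derive_comm m n (f : V -> 'M[R]_(m, n)) u a b :
  (\forall v \near u, differentiable f v) ->
  differentiable ('D_a f) u -> differentiable ('D_b f) u ->
  'D_b ('D_a f) u = 'D_a ('D_b f) u.
Proof.
move=> nf da db; apply/matrixP => i j.
have E c : \near u, 'D_c f u i j = 'D_c (fun v => f v i j) u.
  by near=> v; rewrite derive_coord //; near: v.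
have E' c : \near u, 'D_c (fun v => f v i j) u = 'D_c f u i j.
  by near=> v; rewrite derive_coord //; near: v.
apply: (etrans (derive_coord b i j da)); apply/esym.
apply: (etrans (derive_coord a i j db)).
apply: (etrans (near_eq_derive _ (E b))); apply/esym.
apply: (etrans (near_eq_derive _ (E a))).
apply: derive_comm_scalar.
- by near=> v; have /differentiable_mxP : differentiable f v by near: v.
- by apply: near_eq_differentiable (E a) _; move/differentiable_mxP : da.
- by apply: near_eq_differentiable (E b) _; move/differentiable_mxP : db.
Unshelve. all: by end_near. Qed.

(** Mean value theorem on the segment from u to v, which stays in the ball. *)
Lemma derive0_cst_ball (f : V -> R) u (r : R) :
  (forall v, ball u r v -> forall a, derivable f v a /\ 'D_a f v = 0) ->
  forall v, ball u r v -> f v = f u.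
Proof.
move=> df v uv; pose w := v - u.
have seg t : 0 <= t <= 1 -> ball u r (u + t *: w).
  move=> /andP[t0 t1]; move: uv; rewrite -ball_normE /= => uv.
  rewrite opprD addNKr normrN normrZ (ger0_norm t0).
  by apply: le_lt_trans uv; rewrite distrC ler_piMl.
have [| |c _] := @MVT _ (fun t => f (u + t *: w)) (fun=> 0) _ _ (@ltr01 R).
- move=> t; rewrite in_itv /= => /andP[t0 t1].
  have [|dt <-] := df (u + t *: w) _ w; first by apply: seg; rewrite !ltW.
  exact: line_is_derive.
- apply: derivable_within_continuous => t; rewrite in_itv /= => t01.
  have [dt _] := df _ (seg _ t01) w.
  by have [] := line_is_derive dt.
by rewrite mul0r scale0r scale1r addr0 /w subrKC => /subr0_eq.
Qed.

End Calculus.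

(** * Pseudo-Euclidean linear algebra *)

Section PseudoEuclidean.
Context {R : realType}.

Section InnerProduct.
Variables m k : nat.
Implicit Types v w x : 'rV[R]_m.

Lemma ipC v w : ip k v w = ip k w v.
Proof. by apply: eq_bigr => i _; rewrite mulrAC. Qed.

Lemma ipDl v w x : ip k (v + w) x = ip k v x + ip k w x.
Proof. by rewrite -big_split /=; apply: eq_bigr => i _; rewrite !mxE; ring. Qed.

Lemma ipZl c v x : ip k (c *: v) x = c * ip k v x.
Proof. by rewrite mulr_sumr; apply: eq_bigr => i _; rewrite !mxE; ring. Qed.

Lemma ipDr v w x : ip k x (v + w) = ip k x v + ip k x w.
Proof. by rewrite ipC ipDl !(ipC _ x). Qed.

Lemma ipZr c v x : ip k x (c *: v) = c * ip k x v.
Proof. by rewrite ipC ipZl ipC. Qed.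

Lemma ipNl v x : ip k (- v) x = - ip k v x.
Proof. by rewrite -scaleN1r ipZl mulN1r. Qed.

Lemma ipBl v w x : ip k (v - w) x = ip k v x - ip k w x.
Proof. by rewrite ipDl ipNl. Qed.

Lemma ipBr v w x : ip k x (v - w) = ip k x v - ip k x w.
Proof. by rewrite ipC ipBl !(ipC _ x). Qed.

Lemma ip0l x : ip k 0 x = 0.
Proof. by rewrite -(scale0r x) ipZl mul0r. Qed.

Lemma ip0r x : ip k x 0 = 0.
Proof. by rewrite ipC ip0l. Qed.

Lemma ip_suml (I : Type) (r : seq I) (P : pred I) (F : I -> 'rV[R]_m) x :
  ip k (\sum_(i <- r | P i) F i) x = \sum_(i <- r | P i) ip k (F i) x.
Proof.
elim/big_rec2 : _ => [|i y v _ <-]; [exact: ip0l|exact: ipDl].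
Qed.

Lemma ip_sumr (I : Type) (r : seq I) (P : pred I) (F : I -> 'rV[R]_m) x :
  ip k x (\sum_(i <- r | P i) F i) = \sum_(i <- r | P i) ip k x (F i).
Proof. by rewrite ipC ip_suml; apply: eq_bigr => i _; rewrite ipC. Qed.

Lemma ip_mulmx d e (A : 'M[R]_(d, m)) (B : 'M[R]_(e, m)) i j :
  (A *m diag_mx (ip_sign m k) *m B^T) i j = ip k (row i A) (row j B).
Proof.
rewrite mxE; apply: eq_bigr => l _; rewrite mul_mx_diag !mxE; ring.
Qed.

Lemma ip_sign_sqr (i : 'I_m) : (ip_sign m k 0 i : R) * ip_sign m k 0 i = 1.
Proof. by rewrite !mxE; case: ifP => _; ring. Qed.

Lemma ip_deltar (j : 'I_m) v :
  ip k v (delta_mx 0 j) = ip_sign m k 0 j * v 0 j.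
Proof.
rewrite /ip (bigD1 j) //= big1 => [|i ij].
  by rewrite addr0 [delta_mx _ _ _ _]mxE !eqxx mulr1.
by rewrite [delta_mx _ _ _ _]mxE eqxx (negPf ij) mulr0.
Qed.

Lemma diag_ip_sign_unit : diag_mx (ip_sign m k : 'rV[R]_m) \in unitmx.
Proof.
rewrite unitmxE det_diag unitfE; apply/prodf_neq0 => i _.
apply/eqP => s0; have := ip_sign_sqr i.
by rewrite s0 mul0r => /eqP; rewrite eq_sym oner_eq0.
Qed.
End InnerProduct.

(** The d rows of F span a non-degenerate space and nu is a non-zero vector orthogonal to it, so
    together they span d + 1 dimensions and their orthogonal is a line. Being null, nu lies in that
    line. *)
Lemma null_orth_line d k (F : 'M[R]_(d, d.+2)) (nu v : 'rV[R]_d.+2) :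
  (forall c : 'rV_d, (forall i, ip k (c *m F) (row i F) = 0) -> c = 0) ->
  null_vector k nu -> (forall i, ip k nu (row i F) = 0) ->
  (forall i, ip k v (row i F) = 0) -> ip k v nu = 0 ->
  exists t, v = t *: nu.
Proof.
move=> ndF [/eqP nu0 nunu] nuF vF vnu.
pose K := col_mx F nu; pose A := diag_mx (ip_sign d.+2 k) *m K^T.
have rowK (i : 'I_(d + 1)) :
    row i K = if fintype.split i is inl j then row j F else nu.
  apply/rowP => j; rewrite !mxE; case: (fintype.split i) => l; rewrite ?mxE //.
  by rewrite ord1.
have kerA w : (forall i, ip k w (row i F) = 0) -> ip k w nu = 0 ->
    (w <= kermx A)%MS.
  move=> wF wnu; apply/sub_kermxP/rowP => i; rewrite /A mulmxA ip_mulmx.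
  by rewrite row_id rowK mxE; case: (fintype.split i) => // j; rewrite wF.
have frK : row_free K.
  apply: inj_row_free => c; rewrite -[c]hsubmxK mul_row_col.
  set c1 := lsubmx c; set c2 := rsubmx c => cK.
  have c2E : c2 *m nu = c2 0 0 *: nu by rewrite {1}[c2]mx11_scalar mul_scalar_mx.
  (* The part c1 F is a multiple of nu, hence orthogonal to every row of F, and non-degeneracy
     removes it. *)
  have c10 : c1 = 0.
    apply: ndF => i.
    have -> : c1 *m F = - (c2 *m nu).
      by apply/eqP; rewrite -subr_eq0 opprK cK.
    by rewrite c2E ipNl ipZl nuF mulr0 oppr0.
  move: cK; rewrite c10 mul0mx add0r c2E => /eqP; rewrite scaler_eq0 (negPf nu0).
  rewrite orbF => /eqP c20; rewrite [c2]mx11_scalar c20.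
  by apply/rowP => j; rewrite !mxE; case: splitP => l _; rewrite !mxE ?mul0rn.
have rkA : \rank (kermx A) = 1%N.
  rewrite mxrank_ker /A -mxrank_tr trmx_mul trmxK mxrankMfree.
    by move/eqP: frK => ->; rewrite addn1 subSnn.
  by rewrite row_free_unit unitmx_tr diag_ip_sign_unit.
have nuA : (nu <= kermx A)%MS by exact: kerA.
have : (kermx A <= nu)%MS.
  by rewrite -(geq_leqif (mxrank_leqif_sup nuA)) rkA lt0n mxrank_eq0.
by move/(submx_trans (kerA _ vF vnu))/sub_rVP.
Qed.

Lemma wide_kernel a b (M : 'M[R]_(a, b)) :
  (b < a)%N -> exists2 c : 'rV_a, c != 0 & c *m M = 0.
Proof.
move=> ba; have : ~~ row_free M.
  by rewrite -row_leq_rank -ltnNge; apply: leq_ltn_trans (rank_leq_col M) ba.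
rewrite -kermx_eq0 => /rowV0Pn[c /sub_kermxP cM c0]; by exists c.
Qed.

(* Orthonormalised frame [E] of signature (k, d - k): a vector spanned by the
   [a] coordinate axes of sign [s] and orthogonal to the [b < a] frame vectors
   of sign [s] has a normal part of sign [s]. *)
Lemma normal_vector_sign d k a b (E : 'M[R]_(d, d.+2)) (s : R)
    (g : 'I_a -> 'I_d.+2) (h : 'I_b -> 'I_d) :
  (forall i j, ip k.+1 (row i E) (row j E) = (ip_sign d k 0 i) *+ (i == j)) ->
  s * s = 1 -> injective g -> (forall j, ip_sign d.+2 k.+1 0 (g j) = s) ->
  (forall i, ip_sign d k 0 i = s \/ ip_sign d k 0 i = - s) ->
  (forall i, ip_sign d k 0 i = s -> exists j, h j = i) ->
  (b < a)%N ->
  exists2 v : 'rV[R]_d.+2, (forall i, ip k.+1 v (row i E) = 0) &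
    0 < s * ip k.+1 v v.
Proof.
move=> EE ss ginj gs sE hs ba.
pose M := \matrix_(j < a, i < b)
  ip k.+1 (delta_mx 0 (g j) : 'rV[R]_d.+2) (row (h i) E).
(* There are [a] unknown coordinates and only [b] orthogonality conditions. *)
have [c c0 cM] := wide_kernel M ba.
pose y : 'rV[R]_d.+2 := \sum_j c 0 j *: delta_mx 0 (g j).
have yE i : ip k.+1 y (row (h i) E) = 0.
  move/rowP/(_ i) : cM; rewrite !mxE => <-; rewrite ip_suml.
  by apply: eq_bigr => j _; rewrite ipZl mxE.
have yg j : y 0 (g j) = c 0 j.
  rewrite summxE (bigD1 j) //= big1 => [|l lj]; last first.
    by rewrite !mxE eqxx (inj_eq ginj) eq_sym (negPf lj) mulr0.
  by rewrite !mxE !eqxx mulr1 addr0.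
have yy : 0 < s * ip k.+1 y y.
  rewrite {2}/y ip_sumr mulr_sumr.
  have -> : \sum_j s * ip k.+1 y (c 0 j *: delta_mx 0 (g j)) =
      \sum_j c 0 j ^+ 2.
    apply: eq_bigr => j _; rewrite ipZr ip_deltar gs yg.
    by transitivity (s * s * c 0 j ^+ 2); [ring|rewrite ss mul1r].
  rewrite lt_def sumr_ge0 => [|j _]; last exact: sqr_ge0.
  rewrite andbT psumr_eq0 => [|j _]; last exact: sqr_ge0.
  apply: contra c0 => /allP c0; apply/eqP/rowP => j; rewrite mxE.
  by have := c0 j (mem_index_enum j); rewrite sqrf_eq0 => /eqP.
(* Subtracting the components along the frame makes the vector normal. Only frame vectors of sign -s
   contribute, and each adds a square to s <v, v>, which therefore stays at least s <y, y>. *)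
pose v := y - \sum_i (ip_sign d k 0 i * ip k.+1 y (row i E)) *: row i E.
have vE i : ip k.+1 v (row i E) = 0.
  rewrite ipBl [X in _ - X]ip_suml (bigD1 i) //= [X in _ - (_ + X)]big1 => [|j ji].
    by rewrite ipZl EE eqxx mulr1n addr0 mulrAC ip_sign_sqr mul1r; exact: subrr.
  by rewrite ipZl EE (negPf ji) mulr0.
exists v => //.
have -> : ip k.+1 v v = ip k.+1 v y.
  rewrite {2}/v ipBr [X in _ - X]ip_sumr big1 ?subr0 // => i _.
  by rewrite ipZr vE mulr0.
rewrite ipBl mulrBr [X in _ - s * X]ip_suml [X in _ - X]mulr_sumr subr_gt0.
apply: le_lt_trans yy.
apply: sumr_le0 => i _; rewrite ipZl ![ip _ (row i E) y]ipC.
have [si|si] := sE i.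
  by have [j <-] := hs _ si; rewrite yE !mulr0.
rewrite si; have -> : s * (- s * ip k.+1 y (row i E) * ip k.+1 y (row i E)) =
    - (s * s * ip k.+1 y (row i E) ^+ 2) by ring.
by rewrite ss mul1r oppr_le0 sqr_ge0.
Qed.

(* Polarising twice, [ip k (H a b) (H c d)] changes sign when b and d are
   exchanged; by symmetry of H, three such exchanges give it back. *)
Lemma isotropic_bilinear (V : zmodType) m k (H : V -> V -> 'rV[R]_m) :
  (forall a b, H a b = H b a) ->
  (forall a b c, H (a + b) c = H a c + H b c) ->
  (forall a b, ip k (H a b) (H a b) = 0) ->
  forall a b c d, ip k (H a b) (H c d) = 0.
Proof.
move=> Hsym HDl hh.
have HDr a b c : H a (b + c) = H a b + H a c by rewrite Hsym HDl !(Hsym a).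
have two (x : R) : x + x = 0 -> x = 0.
  by move=> /eqP; rewrite -mulr2n mulrn_eq0 => /eqP.
have H1 a b c : ip k (H a b) (H c b) = 0.
  have := hh (a + c) b; rewrite HDl ipDl !ipDr !hh add0r addr0.
  by rewrite (ipC k (H c b) (H a b)) => /two.
have H2 a b c d : ip k (H a b) (H c d) = - ip k (H a d) (H c b).
  have := H1 a (b + d) c; rewrite !HDr ipDl !ipDr !H1 add0r addr0.
  by move=> /eqP; rewrite addr_eq0 => /eqP.
move=> a b c d; apply: two; rewrite {1}H2 (Hsym c b) H2 opprK (Hsym b d) H2.
by rewrite (Hsym d c) addNr.
Qed.

(** The polynomial A + 2 B t + C t^2 has a non-negative discriminant, as A C < 0, and [t] is one of
    its roots. The vector is non-zero, since v = -t w would give <v, v> = t^2 <w, w> <= 0. *)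
Lemma indefinite_null m k (v w : 'rV[R]_m) :
  0 < ip k v v -> ip k w w < 0 ->
  exists t : R, null_vector k (v + t *: w).
Proof.
move=> vv ww; set A := ip k v v in vv *; set C := ip k w w in ww *.
set B := ip k v w; pose D := B ^+ 2 - A * C.
have D0 : 0 <= D.
  by rewrite subr_ge0; apply: le_trans (sqr_ge0 _); rewrite pmulr_rle0 // ltW.
have C0 : C != 0 by rewrite lt_eqF.
exists ((- B - Num.sqrt D) / C); set t := _ / C; split.
  move=> vw; have vE : v = - (t *: w) by apply/eqP; rewrite -addr_eq0 vw.
  move: vv; rewrite /A vE ipNl ipC ipNl opprK ipZl ipZr -/C mulrA => vv.
  have : t * t * C <= 0 by rewrite -expr2 mulr_ge0_le0 ?sqr_ge0 // ltW.
  by rewrite leNgt vv.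
rewrite !(ipDl, ipDr, ipZl, ipZr) (ipC _ w v) -/A -/B -/C.
have -> : A + t * B + (t * B + t * (t * C)) = (Num.sqrt D ^+ 2 - D) / C.
  by rewrite /t /D; field.
by rewrite sqr_sqrtr // subrr mul0r.
Qed.

(** Compared with the frame, the ambient space has one more axis of each sign: k + 1 against k
    positive ones, d - k + 1 against d - k negative ones. So there are normal vectors of both signs,
    and a combination of them is null. *)
Lemma null_normal_exists d k (E : 'M[R]_(d, d.+2)) : (k <= d)%N ->
  (forall i j, ip k.+1 (row i E) (row j E) = (ip_sign d k 0 i) *+ (i == j)) ->
  exists2 w, null_vector k.+1 w & forall i, ip k.+1 w (row i E) = 0.
Proof.
move=> kd EE.
have sgn (i : 'I_d) : (ip_sign d k 0 i = 1 :> R) \/ (ip_sign d k 0 i = -1 :> R).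
  by rewrite mxE; case: ifP => _; [left|right].
have N11 : (1 : R) <> -1.
  by move/eqP; rewrite -subr_eq0 opprK -mulr2n pnatr_eq0.
have lt_f (j : 'I_k.+1) : ((j : nat) < d.+2)%N.
  by apply: leq_trans (ltn_ord j) _; rewrite ltnS (leq_trans kd).
have [||||||v vE vv] :=
  @normal_vector_sign d k k.+1 k E 1 (fun j => inord j) (widen_ord kd) EE.
- by rewrite mul1r.
- by move=> i j /(congr1 val) /=; rewrite !inordK //; exact: val_inj.
- by move=> j; rewrite mxE inordK // ltn_ord.
- exact: sgn.
- move=> i; rewrite mxE; case: ifP => [ik _|_ /esym/N11 //].
  by exists (Ordinal ik); apply: val_inj.
- by [].
have lt_g (j : 'I_(d - k).+1) : (k.+1 + j < d.+2)%N.
  by rewrite addSn !ltnS -[X in (_ <= X)%N](subnKC kd) leq_add2l -ltnS.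
(* The negative axes of the ambient space start at the index k + 1, the negative frame vectors at
   the index k. *)
have [||||||w wE ww] := @normal_vector_sign d k (d - k).+1 (d - k) E (-1)
    (fun j => inord (k.+1 + j)) (fun j => cast_ord (subnKC kd) (rshift k j)) EE.
- by rewrite mulrNN mul1r.
- move=> i j /(congr1 val) /=; rewrite !inordK // => /eqP.
  by rewrite eqn_add2l => /eqP; exact: val_inj.
- by move=> j; rewrite mxE inordK // ltnNge leq_addr.
- by move=> i; rewrite opprK; case: (sgn i); [right|left].
- move=> i; rewrite mxE; case: ltnP => [_ /N11 //|ki _].
  have ik : (i - k < d - k)%N by rewrite ltn_sub2r // (leq_ltn_trans ki).
  by exists (Ordinal ik); apply: val_inj; rewrite /= subnKC.
- exact: ltnSn.
have [||t nt] := @indefinite_null _ k.+1 v w.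
- by rewrite mul1r in vv.
- by rewrite mulN1r oppr_gt0 in ww.
exists (v + t *: w) => // i.
by rewrite ipDl ipZl vE wE mulr0 addr0.
Qed.

End PseudoEuclidean.

(** * Geometry of a parametrization *)

(** Rows indexed by ['I_kap] stand for the position vector: one row on the sphere, none in flat
    space. *)
Lemma ord_bool_eq (b : bool) (i j : 'I_b) : i = j.
Proof. by case: b i j => [|[]//] i j; rewrite !ord1. Qed.

(** Bookkeeping for the derivative of a Christoffel identity: G and G2 are Christoffel symbols, g is
    a column of the Gram matrix and A + B its derivative. The terms G B occur on both sides and
    cancel; the terms G A become products of Christoffel symbols. *)
Lemma sum_product_rule (R : realType) n (dG G g A B : 'I_n -> R)
    (G2 : 'I_n -> 'I_n -> R) (T Q : R) :
  (forall r, \sum_l G2 l r * g l = A r) ->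
  \sum_l (dG l * g l + G l * (A l + B l)) = T + (Q + \sum_l G l * B l) ->
  \sum_l (dG l + \sum_r G2 l r * G r) * g l = T + Q.
Proof.
move=> HA; rewrite addrA.
have -> : \sum_l (dG l * g l + G l * (A l + B l)) =
    \sum_l (dG l * g l + G l * A l) + \sum_l G l * B l.
  by rewrite -big_split; apply: eq_bigr => l _ /=; ring.
move=> /addIr <-; rewrite big_split /=.
under eq_bigr do rewrite mulrDl; rewrite big_split /=; congr (_ + _).
under eq_bigr do rewrite mulr_suml; rewrite exchange_big /=.
apply: eq_bigr => r _; rewrite -HA mulr_sumr; apply: eq_bigr => l _; ring.
Qed.

Lemma sum_symmetric_scale (R : comPzRingType) (V : lmodType R) n
    (g : 'I_n -> 'I_n -> R) (A B : 'I_n -> R) (N : R) (x : V) :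
  (forall i j, g i j = g j i) ->
  \sum_i \sum_j (g i j * (A j * N)) *: (B i *: x) =
  \sum_i \sum_j (g i j * (B j * N)) *: (A i *: x).
Proof.
move=> gC; rewrite exchange_big; apply: eq_bigr => i _; apply: eq_bigr => j _.
rewrite !scalerA gC; congr (_ *: _); ring.
Qed.

Section Chart.
Context {R : realType}.
Variables (kap : bool) (n p : nat).
Local Notation m := (kap + n).+2.
Local Notation K := (kap + p).+1.
Variables (amb : 'rV[R]_m -> 'rV[R]_m -> 'rV[R]_m).
Variables (U : set 'rV[R]_n) (f : 'rV[R]_n -> 'rV[R]_m).
Hypothesis ambE : forall x v, amb x v = v - (kap%:R * ip K v x) *: x.
Hypothesis openU : open U.
Hypothesis smoothf : smooth_on U f.
Hypothesis gramU : forall u, U u -> gram K f u \in unitmx.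
Hypothesis fS : kap -> forall u, U u -> ip K (f u) (f u) = 1.

Local Notation gi := (gram_inv K f).
Local Notation nor := (nor_part K amb f).
Local Notation pd i := (pderive i f).

(** * Regularity of the chart and products with the position vector *)

Lemma nearU u : U u -> \forall v \near u, U v.
Proof. by move=> Uu; exact: open_nbhs_nbhs. Qed.

Lemma derive_eqU (W : normedModType R) (X Y : 'rV[R]_n -> W) u a :
  (forall v, U v -> X v = Y v) -> U u -> 'D_a X u = 'D_a Y u.
Proof.
by move=> XY Uu; apply: near_eq_derive; near=> v; apply: XY; near: v; exact: nearU.
Unshelve. all: by end_near. Qed.

Lemma derive_cstU (W : normedModType R) (X : 'rV[R]_n -> W) c u a :
  (forall v, U v -> X v = c) -> U u -> 'D_a X u = 0.
Proof. by move=> Xc Uu; rewrite (derive_eqU (Y := cst c)) // derive_cst. Qed.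

Lemma differentiable_eqU (W : normedModType R) (X Y : 'rV[R]_n -> W) u :
  (forall v, U v -> X v = Y v) -> U u -> differentiable X u ->
  differentiable Y u.
Proof.
move=> XY Uu; apply: near_eq_differentiable.
by near=> v; apply: XY; near: v; exact: nearU.
Unshelve. all: by end_near. Qed.

Lemma df u : U u -> differentiable f u.
Proof. exact: (smoothf [::]). Qed.

Lemma dDf a u : U u -> differentiable ('D_a f) u.
Proof. exact: (smoothf [:: a]). Qed.

Lemma dDDf a b u : U u -> differentiable ('D_a ('D_b f)) u.
Proof. exact: (smoothf [:: a; b]). Qed.

Lemma DDf_sym a b u : U u -> 'D_a ('D_b f) u = 'D_b ('D_a f) u.
Proof.
move=> Uu; apply: derive_comm; [|exact: dDf|exact: dDf].
by near=> v; apply: df; near: v; exact: nearU.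
Unshelve. all: by end_near. Qed.

Lemma DfE a u : U u -> 'D_a f u = \sum_i a 0 i *: pd i u.
Proof.
move=> Uu; rewrite deriveE; last exact: df.
rewrite [in LHS](row_sum_delta a) linear_sum; apply: eq_bigr => i _.
by rewrite linearZ /= /pderive deriveE //; exact: df.
Qed.

Lemma kap_cases : kap%:R = 0 :> R \/
  (kap%:R = 1 :> R /\ forall u, U u -> ip K (f u) (f u) = 1).
Proof.
case/orP: (orbN kap) => [k1|/negPf k0]; last by left; rewrite k0.
by right; split; [rewrite k1|exact: fS].
Qed.

Lemma Df_f a u : U u -> kap%:R * ip K ('D_a f u) (f u) = 0.
Proof.
move=> Uu; have [->|[-> ff]] := kap_cases; first by rewrite mul0r.
rewrite mul1r; have := derive_cstU a ff Uu.
rewrite derive_ip; [|exact: df|exact: df].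
by rewrite (ipC K (f u) ('D_a f u)) -mulr2n => /eqP; rewrite mulrn_eq0 => /eqP.
Qed.

(** Product rule; with c = [kap%:R] it covers the relations with f that are empty in flat space. *)
Lemma derive_ip_eq0 (X Y : 'rV[R]_n -> 'rV[R]_m) u a (c : R) :
  (forall v, U v -> c * ip K (X v) (Y v) = 0) -> U u ->
  differentiable X u -> differentiable Y u ->
  c * ip K ('D_a X u) (Y u) = - (c * ip K (X u) ('D_a Y u)).
Proof.
move=> XY Uu dX dY; have := derive_cstU a XY Uu.
rewrite (deriveZ c); last exact/diff_derivable/differentiable_ip.
rewrite derive_ip // /GRing.scale /= mulrDr => /eqP.
by rewrite addr_eq0 => /eqP.
Qed.

Lemma derive_ip_orth (X Y : 'rV[R]_n -> 'rV[R]_m) u a :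
  (forall v, U v -> ip K (X v) (Y v) = 0) -> U u ->
  differentiable X u -> differentiable Y u ->
  ip K ('D_a X u) (Y u) = - ip K (X u) ('D_a Y u).
Proof.
move=> XY Uu dX dY; rewrite -[LHS]mul1r -[ip K (X u) _]mul1r.
by apply: derive_ip_eq0 (Uu) (dX) (dY) => v Uv; rewrite XY // mulr0.
Qed.

(** For kap = 1 this is the component of the second derivative along f, that is, the second
    fundamental form of the sphere. *)
Lemma DDf_f a b u : U u -> kap%:R * ip K ('D_a ('D_b f) u) (f u) =
  - (kap%:R * ip K ('D_a f u) ('D_b f u)).
Proof.
move=> Uu; rewrite (ipC K ('D_a f u)).
apply: derive_ip_eq0 (Uu) (dDf b Uu) (df Uu) => v Uv; exact: Df_f.
Qed.

(** * Tangential and normal projections *)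

(** The factor [kap%:R] imposes orthogonality to the position vector on the sphere only. *)
Definition normal u (v : 'rV[R]_m) : Prop :=
  kap%:R * ip K v (f u) = 0 /\ forall i, ip K v (pd i u) = 0.

Lemma normalZ u c v : normal u v -> normal u (c *: v).
Proof.
move=> [vf vi]; split=> [|i]; first by rewrite ipZl mulrCA vf mulr0.
by rewrite ipZl vi mulr0.
Qed.

Lemma normal_Df u v a : U u -> normal u v -> ip K v ('D_a f u) = 0.
Proof.
move=> Uu [_ vi]; rewrite DfE // ip_sumr big1 // => i _.
by rewrite ipZr vi mulr0.
Qed.

Lemma gram_sym u i j : gram K f u i j = gram K f u j i.
Proof. by rewrite mxE [RHS]mxE; exact: ipC. Qed.

Lemma gi_sym u i j : gi u i j = gi u j i.
Proof.
have : (gi u)^T = gi u.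
  rewrite /gram_inv trmx_inv; congr invmx; apply/matrixP => k l.
  by rewrite mxE gram_sym.
by move/matrixP/(_ i j); rewrite mxE.
Qed.

Lemma gi_gram u i l : U u ->
  \sum_j gi u i j * gram K f u j l = (i == l)%:R.
Proof.
by move=> Uu; have /matrixP/(_ i l) := mulVmx (gramU Uu); rewrite !mxE.
Qed.

Lemma gram_cancel u (x y : 'I_n -> R) : U u ->
  (forall s, \sum_l x l * gram K f u l s = \sum_l y l * gram K f u l s) ->
  forall l, x l = y l.
Proof.
move=> Uu xy l; pose X := \row_l x l; pose Y := \row_l y l.
suff /rowP/(_ l) : X = Y by rewrite !mxE.
rewrite -[X](mulmxK (gramU Uu)) -[Y](mulmxK (gramU Uu)); congr (_ *m _).
apply/rowP => s; rewrite !mxE; under eq_bigr do rewrite mxE.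
by rewrite xy; under [RHS]eq_bigr do rewrite mxE.
Qed.

(** Coordinates of the tangential projection of w in the frame d_i f; for w = D_i d_j f they turn
    out to be the Christoffel symbols. *)
Definition tcoef u (w : 'rV[R]_m) i : R := \sum_j gi u i j * ip K w (pd j u).

(** As f is orthogonal to the tangent vectors when kap = 1, applying [amb] first does not change the
    tangential coefficients. *)
Lemma norE u w : U u -> nor u w =
  w - (kap%:R * ip K w (f u)) *: f u - \sum_i tcoef u w i *: pd i u.
Proof.
move=> Uu; rewrite /nor_part ambE; congr (_ - _); apply: eq_bigr => i _.
rewrite -scaler_suml; congr (_ *: _); apply: eq_bigr => j _; congr (_ * _).
rewrite ipBl ipZl -mulrA mulrCA [ip _ (f u) _]ipC Df_f //.
by rewrite mulr0 subr0.
Qed.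

Lemma tcoef_gram u w l : U u ->
  \sum_i tcoef u w i * gram K f u i l = ip K w (pd l u).
Proof.
move=> Uu; under eq_bigr do rewrite mulr_suml; rewrite exchange_big /=.
rewrite (bigD1 l) //= [X in _ + X]big1 ?addr0 => [|j jl].
  under eq_bigr do rewrite gi_sym mulrAC.
  by rewrite -mulr_suml gi_gram // eqxx mul1r.
under eq_bigr do rewrite gi_sym mulrAC.
by rewrite -mulr_suml gi_gram // (negPf jl) mul0r.
Qed.

Lemma nor_normal u w : U u -> normal u (nor u w).
Proof.
move=> Uu; split=> [|l]; rewrite norE // !ipBl ip_suml ipZl.
  rewrite !mulrBr [X in _ - X]mulr_sumr [X in _ - X]big1 ?subr0 => [|i _].
    have [->|[-> ff]] := kap_cases; first by rewrite !mul0r subrr.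
    by rewrite ff // !mul1r mulr1 subrr.
  by rewrite ipZl mulrCA Df_f // mulr0.
rewrite -mulrA mulrCA [ip _ (f u) _]ipC Df_f // mulr0 subr0.
rewrite -[X in X - _](tcoef_gram w l Uu); apply/eqP; rewrite subr_eq0; apply/eqP.
by apply: eq_bigr => i _; rewrite ipZl mxE.
Qed.

Lemma nor_ip u v w : U u -> normal u v -> ip K (nor u w) v = ip K w v.
Proof.
move=> Uu [vf vi]; rewrite norE // !ipBl ip_suml ipZl [X in _ - X]big1.
  by rewrite mulrAC [ip _ (f u) _]ipC vf mul0r !subr0.
by move=> i _; rewrite ipZl ipC vi mulr0.
Qed.

Lemma nor_id u v : U u -> normal u v -> nor u v = v.
Proof.
move=> Uu [vf vi]; rewrite norE // vf scale0r subr0 big1 ?subr0 // => i _.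
by rewrite /tcoef big1 ?scale0r // => j _; rewrite vi mulr0.
Qed.

Lemma nor_linear u c v w : U u -> nor u (c *: v + w) = c *: nor u v + nor u w.
Proof.
move=> Uu; rewrite !norE // !scalerBr [X in X + _]addrAC.
have -> : \sum_i tcoef u (c *: v + w) i *: pd i u =
    c *: \sum_i tcoef u v i *: pd i u + \sum_i tcoef u w i *: pd i u.
  rewrite scaler_sumr -big_split /=; apply: eq_bigr => i _.
  rewrite scalerA -scalerDl mulr_sumr -big_split /=; congr (_ *: _).
  by apply: eq_bigr => j _; rewrite ipDl ipZl; ring.
apply/rowP => j; rewrite ipDl ipZl !mxE; ring.
Qed.

Lemma norD u v w : U u -> nor u (v + w) = nor u v + nor u w.
Proof. by move=> Uu; rewrite -{1}[v]scale1r nor_linear // scale1r. Qed.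

Lemma nor0 u : U u -> nor u 0 = 0.
Proof.
move=> Uu; apply: nor_id => //; split=> [|i]; rewrite ip0l ?mulr0 //.
Qed.

Lemma norZ u c v : U u -> nor u (c *: v) = c *: nor u v.
Proof. by move=> Uu; rewrite -[c *: v]addr0 nor_linear // nor0 // addr0. Qed.

Lemma norB u v w : U u -> nor u (v - w) = nor u v - nor u w.
Proof. by move=> Uu; rewrite norD // -scaleN1r norZ // scaleN1r. Qed.

Lemma nor_sum u (I : Type) (r : seq I) (P : pred I) (F : I -> 'rV[R]_m) :
  U u -> nor u (\sum_(i <- r | P i) F i) = \sum_(i <- r | P i) nor u (F i).
Proof.
move=> Uu; elim/big_rec2 : _ => [|i x y _ <-]; first exact: nor0.
exact: norD.
Qed.

Lemma tcoef_pd u i l : U u -> tcoef u (pd i u) l = (l == i)%:R.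
Proof.
by move=> Uu; rewrite -(gi_gram _ _ Uu); apply: eq_bigr => j _; rewrite gram_sym mxE.
Qed.

Lemma nor_pd u i : U u -> nor u (pd i u) = 0.
Proof.
move=> Uu; rewrite norE // Df_f // scale0r subr0 (bigD1 i) //= big1.
  by rewrite addr0 tcoef_pd // eqxx scale1r subrr.
by move=> l li; rewrite tcoef_pd // (negPf li) scale0r.
Qed.

Lemma nor_f u : U u -> kap%:R *: nor u (f u) = 0.
Proof.
move=> Uu; have [->|[k1 ff]] := kap_cases; first by rewrite scale0r.
rewrite norE // ff // k1 mulr1 !scale1r subrr sub0r big1 ?oppr0 // => i _.
rewrite /tcoef big1 ?scale0r // => j _.
by have := Df_f 'e_j Uu; rewrite k1 mul1r ipC => ->; rewrite mulr0.
Qed.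

(** An instance of [null_orth_line], for the frame formed by the d_i f and, if kap = 1, by f. It is
    non-degenerate because the Gram matrix is invertible and f is a unit vector orthogonal to all
    d_i f. *)
Lemma normal_null_line u nu v : U u -> null_vector K nu -> normal u nu ->
  normal u v -> ip K v nu = 0 -> exists t, v = t *: nu.
Proof.
move=> Uu nunu [nuf nui] [vf vi] vnu.
pose F1 : 'M[R]_(kap, m) := \matrix_(i, j) f u 0 j.
pose F2 : 'M[R]_(n, m) := \matrix_(i, j) pd i u 0 j.
pose F := col_mx F1 F2.
have rowF i : row i F =
    if fintype.split i is inr j then pd j u else f u.
  by apply/rowP => j; rewrite !mxE; case: (fintype.split i) => l; rewrite mxE.
have kapI (i : 'I_kap) : kap%:R = 1 :> R by case: (kap) i => // -[].
have orthF w : kap%:R * ip K w (f u) = 0 ->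
    (forall i, ip K w (pd i u) = 0) -> forall i, ip K w (row i F) = 0.
  move=> wf wi i; rewrite rowF; case: (fintype.split i) => j //.
  by move: wf; rewrite (kapI j) mul1r.
apply: (null_orth_line (k := K) (F := F)) => //; [|exact: orthF|exact: orthF].
move=> c cF; rewrite -[c]hsubmxK.
set c1 := lsubmx c; set c2 := rsubmx c.
have cFE : c *m F = (\sum_i c1 0 i) *: f u + \sum_i c2 0 i *: pd i u.
  rewrite -[c]hsubmxK mul_row_col -/c1 -/c2; congr (_ + _).
    by apply/rowP => j; rewrite !mxE mulr_suml; apply: eq_bigr => i _; rewrite !mxE.
  by apply/rowP => j; rewrite !mxE summxE; apply: eq_bigr => i _; rewrite !mxE.
(* Pairing with f isolates the coefficient of f; once it is zero, pairing with the d_s f leaves a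
   system whose matrix is the Gram matrix. *)
have c10 : c1 = 0.
  apply/rowP => i; rewrite [RHS]mxE.
  have := cF (lshift n i); rewrite rowF (unsplitK (inl i)) cFE ipDl ipZl ip_suml.
  rewrite [X in _ + X]big1 ?addr0 => [|j _]; last first.
    by have := Df_f 'e_j Uu; rewrite (kapI i) mul1r ipZl => ->; rewrite mulr0.
  have [/eqP|[_ ->//]] := kap_cases; first by rewrite (kapI i) oner_eq0.
  rewrite mulr1 (bigD1 i) //= big1 ?addr0 // => j.
  by rewrite (ord_bool_eq j i) eqxx.
rewrite c10; suff -> : c2 = 0 by rewrite row_mx0.
apply/rowP => i; rewrite [RHS]mxE; apply: (gram_cancel (u := u) (y := fun=> 0)) => // s.
rewrite [RHS]big1 => [|l _]; last by rewrite mul0r.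
have := cF (rshift kap s); rewrite rowF (unsplitK (inr s)) cFE c10.
rewrite big1 => [|j _]; last by rewrite mxE.
rewrite scale0r add0r ip_suml => H; apply: etrans H.
by apply: eq_bigr => l _; rewrite ipZl; congr (_ * _); rewrite mxE.
Qed.

Lemma dpd i u : U u -> differentiable (pd i) u.
Proof. exact: dDf. Qed.

Lemma dgram u : U u -> differentiable (gram K f) u.
Proof.
move=> Uu; apply/differentiable_mxP => i j; under eq_fun do rewrite mxE.
by apply: differentiable_ip; exact: dpd.
Qed.

Lemma dgi i j u : U u -> differentiable (fun v => gi v i j) u.
Proof.
move=> Uu; apply: (iffRL (differentiable_mxP _ _)) => //.
apply: differentiable_invmx; first exact: dgram.
by near=> v; apply: gramU; near: v; exact: nearU.
Unshelve. all: by end_near. Qed.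

Lemma differentiable_tcoef (X : 'rV[R]_n -> 'rV[R]_m) i u : U u ->
  differentiable X u -> differentiable (fun v => tcoef v (X v) i) u.
Proof.
move=> Uu dX; apply: differentiable_bigsum => j _; apply: differentiableM.
  exact: dgi.
by apply: differentiable_ip => //; exact: dpd.
Qed.

Lemma differentiable_nor (X : 'rV[R]_n -> 'rV[R]_m) u : U u ->
  differentiable X u -> differentiable (fun v => nor v (X v)) u.
Proof.
move=> Uu dX; apply: (differentiable_eqU (X := fun v => X v
    - (kap%:R * ip K (X v) (f v)) *: f v - \sum_i tcoef v (X v) i *: pd i v) _ Uu).
  by move=> v Uv; rewrite norE.
apply: differentiableB; first apply: differentiableB => //.
  apply: differentiable_scalev; last exact: df.
  apply: differentiableM; first exact: differentiable_cst.
  by apply: differentiable_ip => //; exact: df.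
apply: differentiable_bigsum => i _; apply: differentiable_scalev.
  exact: differentiable_tcoef.
exact: dpd.
Qed.


(** * The second fundamental form *)

Local Notation h a b := (sff K amb f a b).

Lemma sff_normal a b u : U u -> normal u (h a b u).
Proof. exact: nor_normal. Qed.

Lemma sff_sym a b u : U u -> h a b u = h b a u.
Proof. by move=> Uu; exact: (congr1 (nor u) (DDf_sym a b Uu)). Qed.

Lemma sffDl a b c u : U u -> h (a + b) c u = h a c u + h b c u.
Proof. by move=> Uu; rewrite /sff (deriveDl _ _ (dDf c Uu)) norD. Qed.

Lemma differentiable_sff a b u : U u -> differentiable (h a b) u.
Proof. by move=> Uu; apply: differentiable_nor (Uu) (dDDf a b Uu). Qed.

Lemma normal_DDf v a b u : U u -> normal u v ->
  ip K v ('D_a ('D_b f) u) = ip K v (h a b u).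
Proof. by move=> Uu nv; rewrite ipC -(nor_ip _ Uu nv) ipC. Qed.

Lemma isotropic_sff u : U u -> (forall a b, ip K (h a b u) (h a b u) = 0) ->
  forall a b c d, ip K (h a b u) (h c d u) = 0.
Proof.
move=> Uu; apply: (isotropic_bilinear (H := fun a b => h a b u)) => [a b|a b c].
  exact: sff_sym.
exact: sffDl.
Qed.

Lemma mean_curvature_null u : (forall a b c d, ip K (h a b u) (h c d u) = 0) ->
  ip K (mean_curvature K amb f u) (mean_curvature K amb f u) = 0.
Proof.
move=> hh; rewrite ipZl ipZr ip_suml big1 ?mulr0 // => i _.
rewrite ip_suml big1 // => j _; rewrite ipZl ip_sumr big1 ?mulr0 // => k _.
by rewrite ip_sumr big1 // => l _; rewrite ipZr hh mulr0.
Qed.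

(** Differentiating <f, nu> = 0 once gives the normality of nu, twice its orthogonality to the
    second derivatives. *)
Lemma hyperplane_normal nu : (forall u, U u -> ip K (f u) nu = 0) ->
  forall u, U u -> normal u nu /\ forall a b, ip K ('D_a ('D_b f) u) nu = 0.
Proof.
move=> fnu u Uu.
have D (X : 'rV[R]_n -> 'rV[R]_m) a v : (forall v, U v -> ip K (X v) nu = 0) ->
    U v -> differentiable X v -> ip K ('D_a X v) nu = 0.
  move=> Xnu Uv dX.
  have := derive_ip_orth a Xnu Uv dX (differentiable_cst nu v).
  by rewrite derive_cst ip0r oppr0.
have D1 a v : U v -> ip K ('D_a f v) nu = 0 by move=> Uv; apply: D (fnu) Uv (df Uv).
split=> [|a b]; last by apply: D (Uu) (dDf b Uu) => v; exact: D1.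
by split=> [|i]; rewrite ipC ?(fnu u Uu) ?mulr0 ?(D1 _ _ Uu).
Qed.

Lemma hyperplane_sff nu a b u : null_vector K nu ->
  (forall u, U u -> ip K (f u) nu = 0) -> U u -> exists t, h a b u = t *: nu.
Proof.
move=> nunu fnu Uu; have [nnu DDnu] := hyperplane_normal fnu Uu.
apply: (normal_null_line Uu nunu nnu (sff_normal _ _ Uu)).
by rewrite (nor_ip _ Uu nnu).
Qed.

(** * Christoffel symbols and the Gauss equation *)

Lemma derive_gram i j r u : U u -> pderive i (fun v => gram K f v j r) u =
  ip K ('D_'e_i (pd j) u) (pd r u) + ip K (pd j u) ('D_'e_i (pd r) u).
Proof.
move=> Uu; have -> : (fun v => gram K f v j r) = (fun v => ip K (pd j v) (pd r v)).
  by apply/funext => v; rewrite mxE.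
exact: derive_ip (dpd j Uu) (dpd r Uu).
Qed.

Lemma pd_sym i j u : U u -> 'D_'e_i (pd j) u = 'D_'e_j (pd i) u.
Proof. exact: DDf_sym. Qed.

(** The three derivatives of the Gram matrix expand into six products. By the symmetry of second
    derivatives they are x + y, x + z and y + z with x = <D_i d_j f, d_r f>, so that their signed
    sum is 2 x. *)
Lemma christoffelE l i j u : U u ->
  christoffel K f l i j u = tcoef u ('D_'e_i (pd j) u) l.
Proof.
move=> Uu; rewrite /christoffel /tcoef mulr_sumr; apply: eq_bigr => r _.
have alg (g x y z a b c : R) : a = x + y -> b = x + z -> c = y + z ->
    2^-1 * (g * (a + b - c)) = g * x by move=> -> -> ->; field.
have S1 := congr1 (fun x => ip K x (pd r u)) (pd_sym j i Uu).
have S2 := etrans (congr1 (fun x => ip K x (pd j u)) (pd_sym r i Uu)) (ipC K _ _).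
have S3 := congr1 (ip K (pd i u)) (pd_sym r j Uu).
exact: (alg _ _ _ _ _ _ _ (derive_gram i j r Uu)
  (etrans (derive_gram j i r Uu) (congr2 +%R S1 erefl))
  (etrans (derive_gram r i j Uu) (congr2 +%R S2 S3))).
Qed.

Lemma differentiable_christoffel l i j u : U u ->
  differentiable (christoffel K f l i j) u.
Proof.
move=> Uu; apply: (differentiable_eqU
  (X := fun v => tcoef v ('D_'e_i (pd j) v) l) _ Uu).
  by move=> v Uv; rewrite christoffelE.
exact: differentiable_tcoef Uu (dDDf _ _ Uu).
Qed.

Lemma christoffel_gram i j s u : U u ->
  \sum_l christoffel K f l i j u * gram K f u l s =
  ip K ('D_'e_i (pd j) u) (pd s u).
Proof.
move=> Uu; rewrite -tcoef_gram //; apply: eq_bigr => l _.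
by rewrite christoffelE.
Qed.

Lemma ip_decomp u x w : U u -> ip K x w =
  ip K (nor u x) (nor u w) + (kap%:R * ip K x (f u)) * ip K w (f u)
  + \sum_l tcoef u x l * ip K (pd l u) w.
Proof.
move=> Uu; have {1}-> : x = nor u x + (kap%:R * ip K x (f u)) *: f u
      + \sum_l tcoef u x l *: pd l u.
  by rewrite norE // addrAC subrK subrK.
rewrite ipDl ipDl ipZl ip_suml (ipC K (f u)).
rewrite (ipC K (nor u x) (nor u w)) (nor_ip _ Uu (nor_normal _ Uu)).
rewrite (ipC K w (nor u x)); congr (_ + _).
by apply: eq_bigr => l _; rewrite ipZl.
Qed.

(** The normal components of the two second derivatives are orthogonal by assumption; those along f
    are given by [DDf_f], whose two minus signs cancel; the tangential ones stay in the sum. *)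
Lemma isotropic_ip_DDf a b c d u : U u ->
  (forall a b c d, ip K (h a b u) (h c d u) = 0) ->
  ip K ('D_a ('D_b f) u) ('D_c ('D_d f) u) =
  kap%:R * (ip K ('D_a f u) ('D_b f u) * ip K ('D_c f u) ('D_d f u)) +
  \sum_l tcoef u ('D_a ('D_b f) u) l * ip K (pd l u) ('D_c ('D_d f) u).
Proof.
move=> Uu hh; apply: (etrans (ip_decomp _ _ Uu)); congr (_ + _).
have alg (k N x y X Y : R) : N = 0 -> k * x = - (k * X) -> k * y = - (k * Y) ->
    N + (k * x) * y = k * (X * Y).
  move=> -> kx ky; rewrite add0r kx.
  by transitivity (- X * (k * y)); [ring|rewrite ky; ring].
exact: alg (hh a b c d) (DDf_f a b Uu) (DDf_f c d Uu).
Qed.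

(* The derivative of [christoffel_gram] along e_i, from which the normal term
   <h(e_j, e_c), h(e_i, e_s)> has dropped out. *)
Lemma gauss_derivative i j c s u : U u ->
  (forall a b c d, ip K (h a b u) (h c d u) = 0) ->
  \sum_l (pderive i (christoffel K f l j c) u + \sum_r
      christoffel K f l i r u * christoffel K f r j c u) * gram K f u l s =
  ip K ('D_'e_i ('D_'e_j (pd c)) u) (pd s u)
    + kap%:R * (gram K f u j c * gram K f u i s).
Proof.
move=> Uu hh.
have dG k l : differentiable (fun v => gram K f v k l) u.
  by have /differentiable_mxP := dgram Uu; exact.
apply: (sum_product_rule (A := fun l => ip K ('D_'e_i (pd l) u) (pd s u))
  (B := fun l => ip K (pd l u) ('D_'e_i (pd s) u))).
  by move=> r; exact: christoffel_gram.
transitivity ('D_'e_i (fun v =>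
    \sum_l christoffel K f l j c v * gram K f v l s) u).
  rewrite derive_bigsum => [|l _]; last first.
    exact: differentiableM (differentiable_christoffel _ _ _ Uu) (dG _ _).
  apply: eq_bigr => l _.
  rewrite (derive_mulf _ (differentiable_christoffel _ _ _ Uu) (dG _ _)).
  by congr (_ + _ * _); apply/esym; exact: derive_gram.
apply: (etrans (derive_eqU _ (fun v Uv => christoffel_gram j c s Uv) Uu)).
apply: (etrans (derive_ip _ _ (dDDf _ _ Uu) (dDf _ Uu))); congr (_ + _).
apply: (etrans (isotropic_ip_DDf _ _ _ _ Uu hh)); congr (_ + _).
  by rewrite mxE [gram K f u i s]mxE.
by apply: eq_bigr => l _; rewrite christoffelE.
Qed.

(** With the upper index lowered by the Gram matrix, the curvature tensor is [gauss_derivative] for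
    (i, j) minus the same for (j, i), and the third derivatives of f cancel by symmetry. What
    remains is the tensor of constant curvature kap. *)
Lemma gauss_equation l c i j u : U u ->
  (forall a b c d, ip K (h a b u) (h c d u) = 0) ->
  riemann K f l c i j u =
  kap%:R * (gram K f u j c *+ (l == i) - gram K f u i c *+ (l == j)).
Proof.
move=> Uu hh; move: l; apply: (gram_cancel Uu) => s.
have -> : \sum_l riemann K f l c i j u * gram K f u l s =
    kap%:R * (gram K f u j c * gram K f u i s)
    - kap%:R * (gram K f u i c * gram K f u j s).
  have S : 'D_'e_i ('D_'e_j (pd c)) u = 'D_'e_j ('D_'e_i (pd c)) u.
    apply: derive_comm; [|exact: dDDf|exact: dDDf].
    by near=> v; apply: dDf; near: v; exact: nearU.
  have E1 := gauss_derivative i j c s Uu hh.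
  have E2 := gauss_derivative j i c s Uu hh.
  rewrite S in E1; set T := ip _ _ _ in E1 E2.
  have -> (x y : R) : x - y = (T + x) - (T + y) by ring.
  rewrite -E1 -E2 -sumrB; apply: eq_bigr => l _.
  have alg (a b X Y z : R) : (a - b + (X - Y)) * z = (a + X) * z - (b + Y) * z.
    by ring.
  by rewrite /riemann sumrB; exact: alg.
have D (x : R) k : \sum_l x *+ (l == k) * gram K f u l s = x * gram K f u k s.
  rewrite (bigD1 k) //= eqxx mulr1n big1 ?addr0 // => l /negPf ->.
  by rewrite mulr0n mul0r.
have alg (k A B z : R) : k * (A - B) * z = k * (A * z - B * z) by ring.
rewrite -mulrBr -(D (gram K f u j c) i) -(D (gram K f u i c) j) -sumrB mulr_sumr.
by apply: eq_bigr => l _; rewrite alg.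
Unshelve. all: by end_near. Qed.

(** The first contraction gives the Ricci tensor kap (n - 1) g, the second the trace n of g. *)
Lemma isotropic_scalar_curvature u : U u ->
  (forall a b c d, ip K (h a b u) (h c d u) = 0) ->
  scalar_curvature K f u = kap%:R * (n%:R * (n%:R - 1)).
Proof.
move=> Uu hh; rewrite /scalar_curvature.
have E j c : \sum_i riemann K f i c i j u =
    kap%:R * (n%:R - 1) * gram K f u j c.
  under eq_bigr do rewrite gauss_equation // eqxx mulr1n.
  rewrite -mulr_sumr sumrB sumr_const card_ord (bigD1 j) //= eqxx big1.
    by rewrite addr0 mulr1n -mulr_natl; ring.
  by move=> i /negPf ->.
have F j : \sum_c gi u j c * \sum_i riemann K f i c i j u = kap%:R * (n%:R - 1).
  under eq_bigr do rewrite E mulrCA gram_sym.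
  by rewrite -mulr_sumr gi_gram // eqxx mulr1.
by under eq_bigr do rewrite F; rewrite sumr_const card_ord -mulr_natl; ring.
Qed.


(** * Normal fields and the Ricci equation *)

Lemma normal_field_normal xi u : normal_field K amb U f xi -> U u ->
  normal u (xi u).
Proof.
move=> [_ nxi] Uu; have [/eqP axi xif] := nxi u Uu; split=> [|i]; last exact: xif.
have [->|[k1 ff]] := kap_cases; first by rewrite mul0r.
move: axi; rewrite ambE -subr_eq0 addrAC subrr add0r oppr_eq0 => /eqP.
move=> /(congr1 (fun w => ip K w (f u))); rewrite ipZl ff // mulr1 => ->.
by rewrite ip0l.
Qed.

(** The inner projection removes the tangential part of D_b xi, which Weingarten's formula expresses
    through the products -<xi, h(b, e_j)>. Differentiating that part and projecting again leaves
    only the terms in which d_i f is differentiated, and these are values of h. *)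
Lemma nor_derive_normal (xi : 'rV[R]_n -> 'rV[R]_m) u a b : U u ->
  (forall v, U v -> normal v (xi v)) -> (forall v, U v -> differentiable xi v) ->
  differentiable ('D_b xi) u ->
  nor u ('D_a (fun v => nor v ('D_b xi v)) u) = nor u ('D_a ('D_b xi) u) +
    \sum_i \sum_j (gi u i j * ip K (xi u) (h b 'e_j u)) *: h a 'e_i u.
Proof.
move=> Uu nxi dxi ddxi.
have tc v i : U v -> tcoef v ('D_b xi v) i =
    - \sum_j gi v i j * ip K (xi v) (h b 'e_j v).
  move=> Uv; rewrite /tcoef -sumrN; apply: eq_bigr => j _.
  rewrite -mulrN; congr (_ * _); rewrite -(normal_DDf b 'e_j Uv (nxi v Uv)).
  apply: derive_ip_orth (Uv) (dxi v Uv) (dpd j Uv) => w Uw.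
  by have [_] := nxi w Uw.
(* D_b xi has no component along f: for kap = 1 its product with f is -<xi, D_b f> = 0. *)
have E v : U v -> nor v ('D_b xi v) = 'D_b xi v
    - \sum_i tcoef v ('D_b xi v) i *: pd i v.
  move=> Uv; rewrite norE // (_ : kap%:R * _ = 0) ?scale0r ?subr0 //.
  have := derive_ip_eq0 (X := xi) (Y := f) (c := kap%:R) b _ Uv (dxi v Uv) (df Uv).
  move=> ->; last by move=> w Uw; have [] := nxi w Uw.
  by rewrite (normal_Df _ Uv (nxi v Uv)) mulr0 oppr0.
have dt i : differentiable (fun v => tcoef v ('D_b xi v) i) u.
  exact: differentiable_tcoef.
have dtp i : differentiable (fun v => tcoef v ('D_b xi v) i *: pd i v) u.
  exact: differentiable_scalev (dt i) (dpd i Uu).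
rewrite (derive_eqU a E Uu) deriveB; first last.
- by apply: diff_derivable; apply: differentiable_bigsum => i _; exact: dtp.
- exact: diff_derivable.
rewrite derive_bigsum => [|i _]; last exact: dtp.
rewrite norB //; congr (_ + _); rewrite nor_sum // -sumrN; apply: eq_bigr => i _.
rewrite (derive_scalev _ (dt i) (dpd i Uu)) norD // !norZ // nor_pd // scaler0 add0r.
rewrite tc // scaleNr opprK scaler_suml; exact: eq_bigr.
Qed.

(** The second derivatives of xi commute. In the remaining terms every value of h is a scalar
    multiple of nu, so that exchanging the summation indices i and j exchanges a and b. *)
Lemma ricci_line (xi : 'rV[R]_n -> 'rV[R]_m) nu u a b : U u ->
  (forall a b, exists t, h a b u = t *: nu) ->
  smooth_on U xi -> (forall v, U v -> normal v (xi v)) ->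
  nor u ('D_a (fun v => nor v ('D_b xi v)) u) =
  nor u ('D_b (fun v => nor v ('D_a xi v)) u).
Proof.
move=> Uu hnu sxi nxi.
have dxi v : U v -> differentiable xi v by exact: (sxi [::]).
have dDxi c : differentiable ('D_c xi) u by exact: (sxi [:: c]).
have S : 'D_a ('D_b xi) u = 'D_b ('D_a xi) u.
  apply: derive_comm; [|exact: dDxi|exact: dDxi].
  by near=> v; apply: dxi; near: v; exact: nearU.
suff T : \sum_i \sum_j (gi u i j * ip K (xi u) (h a 'e_j u)) *: h b 'e_i u =
    \sum_i \sum_j (gi u i j * ip K (xi u) (h b 'e_j u)) *: h a 'e_i u.
  exact: (etrans (nor_derive_normal a Uu nxi dxi (dDxi b))
    (etrans (congr2 +%R (congr1 (nor u) S) (esym T))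
      (esym (nor_derive_normal b Uu nxi dxi (dDxi a))))).
have [A HA] := choice (fun i => hnu a 'e_i).
have [B HB] := choice (fun i => hnu b 'e_i).
have E c d (C D : 'I_n -> R) : (forall i, h c 'e_i u = C i *: nu) ->
    (forall i, h d 'e_i u = D i *: nu) ->
    \sum_i \sum_j (gi u i j * ip K (xi u) (h c 'e_j u)) *: h d 'e_i u =
    \sum_i \sum_j (gi u i j * (C j * ip K (xi u) nu)) *: (D i *: nu).
  move=> HC HD; apply: eq_bigr => i _; apply: eq_bigr => j _.
  by rewrite HC HD ipZr.
exact: (etrans (E a b A B HA HB) (etrans
  (sum_symmetric_scale _ _ _ _ (gi_sym u)) (esym (E b a B A HB HA)))).
Unshelve. all: by end_near. Qed.

(** * Constancy of the null direction and of the normal plane *)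

(** The factor in D_a xi = tau xi is known pointwise only, so no equation for xi is integrated.
    Instead, the quotients of the coordinates of xi by a non-vanishing one have derivative zero, and
    the line R xi is constant on a ball. *)
Lemma parallel_null_field (xi : 'rV[R]_n -> 'rV[R]_m) u0 : U u0 ->
  (forall u, U u -> differentiable xi u) -> (forall u, U u -> normal u (xi u)) ->
  (forall u, U u -> null_vector K (xi u)) ->
  (forall u, U u -> forall a b, exists t, h a b u = t *: xi u) ->
  \forall u \near u0, normal u (xi u0).
Proof.
move=> Uu0 dxi nxi xi0 hxi.
have xixi u : U u -> ip K (xi u) (xi u) = 0 by move=> /xi0[].
have Dxi a u : U u -> exists t, 'D_a xi u = t *: xi u.
  move=> Uu; apply: (normal_null_line Uu (xi0 u Uu) (nxi u Uu)).
    split=> [|i].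
      rewrite (derive_ip_eq0 (Y := f) a _ Uu (dxi u Uu) (df Uu)); last first.
        by move=> v Uv; have [] := nxi v Uv.
      by rewrite (normal_Df _ Uu (nxi u Uu)) mulr0 oppr0.
    rewrite (derive_ip_orth (Y := pd i) a _ Uu (dxi u Uu) (dpd i Uu)); last first.
      by move=> v Uv; have [_] := nxi v Uv.
    rewrite (normal_DDf a 'e_i Uu (nxi u Uu)).
    by have [t ->] := hxi u Uu a 'e_i; rewrite ipZr xixi // mulr0 oppr0.
  have := derive_ip_orth a xixi Uu (dxi u Uu) (dxi u Uu).
  rewrite (ipC K (xi u) ('D_a xi u)) => /eqP.
  by rewrite -subr_eq0 opprK -mulr2n mulrn_eq0 => /eqP.
(* The denominator: a coordinate l that is non-zero at u0 and, by continuity, on a ball around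
   it. *)
have [/eqP/rV0Pn[l xil] _] := xi0 u0 Uu0.
have dc j u : U u -> differentiable (fun v => xi v 0 j) u.
  by move=> Uu; have /differentiable_mxP := dxi u Uu; exact.
have nl : \forall u \near u0, U u /\ xi u 0 l != 0.
  apply: filterI; first exact: nearU.
  by have := differentiable_continuous (dc l u0 Uu0) => /cvgr_neq0; exact.
case/nbhs_ballP : nl => r /= r0 hr; apply/nbhs_ballP; exists r => // u ur.
have [Uu xul] := hr u ur.
suff -> : xi u0 = (xi u0 0 l / xi u 0 l) *: xi u by apply: normalZ; exact: nxi.
have Q j : xi u 0 j / xi u 0 l = xi u0 0 j / xi u0 0 l.
  apply: (derive0_cst_ball (f := fun v => xi v 0 j / xi v 0 l)) ur => v /hr[Uv xvl] a.
  have dj := dc j v Uv; have dl := dc l v Uv.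
  have dV : differentiable (fun v => (xi v 0 l)^-1) v by exact: differentiableV.
  split; first by apply: diff_derivable; exact: differentiableM.
  rewrite (derive_mulf _ dj dV) deriveV //; last exact: diff_derivable.
  have [t Dt] := Dxi a v Uv.
  rewrite -(derive_coord a 0 j (dxi v Uv)) -(derive_coord a 0 l (dxi v Uv)) Dt.
  by rewrite !mxE /GRing.scale /=; field.
apply/rowP => j; rewrite mxE.
have alg (x y z w : R) : z != 0 -> y / z = x / w -> w != 0 -> x = w / z * y.
  by move=> z0 e w0; rewrite mulrAC -mulrA e mulrC divfK.
exact: alg xul (Q j) xil.
Qed.

(** The derivative of the projection X of w is normal, because its products with the d_i f are -<X,
    h> = 0. Its normal part vanishes too: w is constant, and the subtracted terms are combinations
    of f and the d_i f, whose derivatives have no normal part when h = 0. *)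
Lemma totally_geodesic_nor u a w : (forall u, U u -> forall a b, h a b u = 0) ->
  U u -> 'D_a (fun v => nor v w) u = 0.
Proof.
move=> h0 Uu; pose X v := nor v w.
have dcw : differentiable (cst w : 'rV[R]_n -> _) u by exact: differentiable_cst.
have dX : differentiable X u by exact: differentiable_nor Uu dcw.
have nX v : U v -> normal v (X v) by exact: nor_normal.
rewrite -/X; have nDX : normal u ('D_a X u).
  split=> [|i].
    rewrite (derive_ip_eq0 (Y := f) a _ Uu dX (df Uu)); last first.
      by move=> v Uv; have [] := nX v Uv.
    by rewrite (normal_Df _ Uu (nX u Uu)) mulr0 oppr0.
  rewrite (derive_ip_orth (Y := pd i) a _ Uu dX (dpd i Uu)); last first.
    by move=> v Uv; have [_] := nX v Uv.
  by rewrite (normal_DDf a 'e_i Uu (nX u Uu)) h0 // ip0r oppr0.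
rewrite -(nor_id Uu nDX).
have dwf : differentiable (fun v => ip K w (f v)) u.
  exact: differentiable_ip dcw (df Uu).
have dkf : differentiable (fun v => kap%:R * ip K w (f v)) u.
  by apply: differentiableM dwf; exact: differentiable_cst.
have d1 := differentiable_scalev dkf (df Uu).
have dt i := differentiable_tcoef i Uu dcw.
have d2 i := differentiable_scalev (dt i) (dpd i Uu).
have dS : differentiable (fun v => \sum_i tcoef v w i *: pd i v) u.
  by apply: differentiable_bigsum => i _; exact: d2.
have E v : U v -> X v = w - (kap%:R * ip K w (f v)) *: f v
    - \sum_i tcoef v w i *: pd i v by move=> Uv; exact: norE.
have norDf : nor u ('D_a f u) = 0.
  rewrite DfE // nor_sum // big1 // => i _; by rewrite norZ // nor_pd // scaler0.
have T1 : nor u ('D_a (fun v => (kap%:R * ip K w (f v)) *: f v) u) = 0.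
  apply: (etrans (congr1 (nor u) (derive_scalev a dkf (df Uu)))).
  rewrite norD // !norZ // norDf scaler0 addr0.
  rewrite (derive_mulf a (differentiable_cst _ _) dwf) derive_cst mul0r add0r.
  by rewrite mulrC -scalerA nor_f // scaler0.
have T2 : nor u ('D_a (fun v => \sum_i tcoef v w i *: pd i v) u) = 0.
  rewrite derive_bigsum => [|i _]; last exact: d2.
  rewrite (nor_sum _ _ _ Uu); apply: big1 => i _.
  apply: (etrans (congr1 (nor u) (derive_scalev a (dt i) (dpd i Uu)))).
  rewrite norD // !norZ // nor_pd // scaler0 add0r.
  by apply: (etrans (congr1 ( *:%R _) (h0 u Uu a 'e_i))); rewrite scaler0.
rewrite (derive_eqU a E Uu) deriveB; first last.
- exact: diff_derivable.
- by apply: diff_derivable; exact: differentiableB.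
rewrite deriveB; [|exact: diff_derivable|exact: diff_derivable].
by rewrite norB // norB // T1 T2 derive_cst nor0 // !subr0.
Qed.

(** A matrix B that diagonalises the Gram matrix turns the d_i f into an orthonormal frame of
    signature (p, n - p), to which f adds one positive vector when kap = 1. *)
Lemma null_normal_at u : U u -> (p <= n)%N ->
  (exists2 B : 'M[R]_n, B \in unitmx &
      B *m gram K f u *m B^T = diag_mx (ip_sign n p)) ->
  exists2 w, null_vector K w & normal u w.
Proof.
move=> Uu pn [B uB BGB].
pose F1 : 'M[R]_(kap, m) := \matrix_(i, j) f u 0 j.
pose J : 'M[R]_(n, m) := \matrix_(i, j) pd i u 0 j.
(* The position vector comes first because [ip_sign] lists the positive directions first. *)
pose E := col_mx F1 (B *m J).
have kapI (i : 'I_kap) : kap%:R = 1 :> R by case: (kap) i => // -[].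
have rowl i : row (lshift n i) E = f u.
  by apply/rowP => j; rewrite mxE col_mxEu mxE.
have rowr i : row (rshift kap i) E = row i (B *m J).
  by apply/rowP => j; rewrite mxE col_mxEd [RHS]mxE.
have BJE i : row i (B *m J) = \sum_l B i l *: pd l u.
  by apply/rowP => j; rewrite !mxE summxE; apply: eq_bigr => l _; rewrite !mxE.
have BJ i j : ip K (row i (B *m J)) (row j (B *m J)) = ip_sign n p 0 i *+ (i == j).
  have /matrixP/(_ i j) := BGB; rewrite [X in _ = X -> _]mxE => <-.
  rewrite BJE ip_suml mxE [RHS](eq_bigr (fun l => \sum_s
    B i s * gram K f u s l * B j l)) => [|l _]; last first.
    by rewrite !mxE mulr_suml.
  rewrite [RHS]exchange_big; apply: eq_bigr => s _; rewrite ipZl BJE ip_sumr mulr_sumr.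
  apply: eq_bigr => l _; rewrite ipZr /= -[RHS]mulrA [gram _ _ _ s l]mxE.
  by rewrite [in RHS](mulrC _ (B j l)).
have fBJ i : kap%:R * ip K (row i (B *m J)) (f u) = 0.
  rewrite BJE ip_suml mulr_sumr big1 // => l _.
  by rewrite ipZl mulrCA Df_f // mulr0.
have [|i j|w w0 wE] := @null_normal_exists R (kap + n) (kap + p) E.
- by rewrite leq_add2l.
- rewrite -(splitK i) -(splitK j).
  case: (fintype.split i) => {}i; case: (fintype.split j) => {}j /=.
  + rewrite !rowl (ord_bool_eq i j) eqxx mxE /= ltn_addr // mulr1n.
    have [/eqP|[_ -> //]] := kap_cases; by rewrite (kapI j) oner_eq0.
  + rewrite rowl rowr eq_shift mulr0n ipC.
    by have := fBJ j; rewrite (kapI i) mul1r.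
  + rewrite rowl rowr eq_shift mulr0n.
    by have := fBJ i; rewrite (kapI j) mul1r.
  + rewrite !rowr BJ eq_shift !mxE /=; congr (_ *+ _).
    by rewrite ltn_add2l.
exists w => //; split=> [|i].
  have [->|[k1 _]] := kap_cases; first by rewrite mul0r.
  have kap0 : (0 < kap)%N.
    by rewrite lt0b; case: (kap) k1 => // /eqP; rewrite eq_sym oner_eq0.
  by have := wE (lshift n (Ordinal kap0)); rewrite rowl => ->; rewrite mulr0.
have wBJ l : ip K w (row l (B *m J)) = 0 by rewrite -rowr wE.
(* Orthogonality passes from the orthonormal frame back to the d_i f through the inverse of B. *)
have -> : pd i u = \sum_l invmx B i l *: row l (B *m J).
  have -> : pd i u = row i J by apply/rowP => j; rewrite !mxE.
  rewrite -[in LHS](mulKmx uB J) row_mul.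
  rewrite mulmx_sum_row; apply: eq_bigr => l _; by rewrite mxE.
by rewrite ip_sumr big1 // => l _; rewrite ipZr wBJ mulr0.
Qed.

End Chart.

(** * Submanifolds of the space forms *)

Section SpaceForm.
Context {R : realType}.
Variables (kap : bool) (n p : nat).
Local Notation m := (kap + n).+2.
Local Notation K := (kap + p).+1.
Variable (amb : 'rV[R]_m -> 'rV[R]_m -> 'rV[R]_m).
Hypothesis ambE : forall x v, amb x v = v - (kap%:R * ip K v x) *: x.
Variable Sigma : set 'rV[R]_m.
Implicit Types (U : set 'rV[R]_n) (f : 'rV[R]_n -> 'rV[R]_m).
Hypothesis SigmaS : kap -> Sigma `<=` unit_sphere m K.

(** The whole domain is an admissible V in the last clause of [local_param]. *)
Lemma local_param_mem U f u : local_param Sigma U f -> U u -> Sigma (f u).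
Proof.
move=> [oU _ _ _ hom] Uu; have [A _ fA] := hom U oU (@subset_refl _ U).
by have [] : (Sigma `&` A) (f u) by rewrite -fA; exists u.
Qed.

Lemma local_param_sphere U f : local_param Sigma U f ->
  kap -> forall u, U u -> ip K (f u) (f u) = 1.
Proof. by move=> lp k u Uu; apply: (SigmaS k); exact: local_param_mem lp Uu. Qed.

Lemma smooth_on_sub (V W : normedModType R) (A B : set V) (g : V -> W) :
  B `<=` A -> smooth_on A g -> smooth_on B g.
Proof. by move=> BA sg vs u /BA; exact: sg. Qed.

(** * Submanifolds contained in the orthogonal of a null vector *)

Section Hyperplane.
Variable nu : 'rV[R]_m.
Hypothesis nunu : null_vector K nu.
Hypothesis ndS : nondegenerate_metric n K Sigma.
Hypothesis Snu : Sigma `<=` orth K nu.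

Lemma hyperplane_local_sff U f u a b : local_param Sigma U f -> U u ->
  exists t, sff K amb f a b u = t *: nu.
Proof.
move=> lp Uu; have [oU sf _ _ _] := lp.
apply: (hyperplane_sff ambE oU sf (ndS lp) (local_param_sphere lp)) => // v Uv.
exact/Snu/(local_param_mem lp).
Qed.

Lemma hyperplane_isotropic U f u a b c d : local_param Sigma U f -> U u ->
  ip K (sff K amb f a b u) (sff K amb f c d u) = 0.
Proof.
move=> lp Uu; have [s ->] := hyperplane_local_sff a b lp Uu.
have [t ->] := hyperplane_local_sff c d lp Uu.
by rewrite ipZl ipZr nunu.2 !mulr0.
Qed.

Lemma hyperplane_null_sff : null_sff n K amb Sigma.
Proof. by move=> U f lp u Uu a b; exact: (hyperplane_isotropic a b a b lp Uu). Qed.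

Lemma hyperplane_marginally_trapped : marginally_trapped n K amb Sigma.
Proof.
move=> U f lp u Uu; apply: mean_curvature_null => a b c d.
exact: (hyperplane_isotropic a b c d lp Uu).
Qed.

Lemma hyperplane_riemann U f u l c i j : local_param Sigma U f -> U u ->
  riemann K f l c i j u =
  kap%:R * (gram K f u j c *+ (l == i) - gram K f u i c *+ (l == j)).
Proof.
move=> lp Uu; have [oU sf _ _ _] := lp.
apply: (gauss_equation ambE oU sf (ndS lp) (local_param_sphere lp)) => // a b d e.
exact: (hyperplane_isotropic a b d e lp Uu).
Qed.

Lemma hyperplane_scalar_curvature : constant_scalar_curvature n K Sigma.
Proof.
exists (kap%:R * (n%:R * (n%:R - 1))) => U f lp u Uu; have [oU sf _ _ _] := lp.
apply: (isotropic_scalar_curvature ambE oU sf (ndS lp) (local_param_sphere lp)).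
  by [].
by move=> a b d e; exact: (hyperplane_isotropic a b d e lp Uu).
Qed.

Lemma hyperplane_flat_normal_bundle : flat_normal_bundle n K amb Sigma.
Proof.
move=> U f lp xi nxi a b u Uu; have [oU sf _ _ _] := lp.
have fS := local_param_sphere lp.
apply/eqP; rewrite subr_eq0; apply/eqP.
apply: (ricci_line ambE oU sf (ndS lp) fS a b Uu (nu := nu)).
- by move=> c d; exact: (hyperplane_local_sff c d lp Uu).
- by have [] := nxi.
- by move=> v Uv; exact: (normal_field_normal ambE fS nxi Uv).
Qed.

End Hyperplane.

(** * The converse: local models *)

(** Common form of [flat_model_at] and [sphere_model_at]: the hyperplane passes through x, and
    through the origin as well when kap = 1. *)
Definition null_model_at (x : 'rV[R]_m) : Prop :=
  exists nu : 'rV[R]_m, [/\ null_vector K nu, kap%:R * ip K x nu = 0 &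
    exists O : set 'rV[R]_m, [/\ open O, O x &
      forall y, Sigma y -> O y -> ip K (y - x) nu = 0]].

(** Where nu is normal, <f, nu> has derivative zero, hence it is constant on a ball of parameters.
    The last clause of [local_param] makes the image of that ball a relatively open part of
    Sigma. *)
Lemma parallel_normal_model U f u0 nu : local_param Sigma U f -> U u0 ->
  null_vector K nu -> (\forall u \near u0, normal p f u nu) ->
  null_model_at (f u0).
Proof.
move=> lp Uu0 nunu nnu; have [oU sf _ _ hom] := lp.
have : \forall u \near u0, U u /\ normal p f u nu.
  by apply: filterI => //; exact: open_nbhs_nbhs.
case/nbhs_ballP => r /= r0 hr.
have [nf _] : normal p f u0 nu by exact: nbhs_singleton nnu.
exists nu; split => //; first by rewrite ipC.
have oV : open (ball u0 r) by exact: ball_open.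
have [|A oA fA] := hom (ball u0 r) oV.
  by move=> u /hr[].
have [_ Ax] : (Sigma `&` A) (f u0).
  by rewrite -fA; exists u0 => //; exact: ballxx.
exists A; split => // y Sy Ay.
have [u ur <-] : (f @` ball u0 r) y by rewrite fA.
rewrite ipBl; apply/eqP; rewrite subr_eq0; apply/eqP.
apply: (derive0_cst_ball (f := fun v => ip K (f v) nu)) ur => v /hr[Uv nv] a.
have dc : differentiable (cst nu : 'rV[R]_n -> _) v by exact: differentiable_cst.
split; first exact: diff_derivable (differentiable_ip _ (df sf Uv) dc).
rewrite (derive_ip _ _ (df sf Uv) dc) derive_cst ip0r addr0 ipC.
exact: (normal_Df sf _ Uv nv).
Qed.

Variable q : nat.
Hypothesis sgS : has_signature n K p q Sigma.
Hypothesis nullS : null_sff n K amb Sigma.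

Lemma signature_gram U f u : local_param Sigma U f -> U u ->
  gram K f u \in unitmx.
Proof.
move=> lp Uu; have [B uB BGB] := sgS.2 U f lp u Uu.
have : B *m gram K f u *m B^T \in unitmx by rewrite BGB diag_ip_sign_unit.
by rewrite !unitmx_mul uB => /andP[].
Qed.

Lemma single_null_direction_model x :
  single_null_direction_at n K amb Sigma x -> null_model_at x.
Proof.
move=> [U [f [xi [lp [u0 Uu0 <-] nxi hxi]]]]; have [oU sf _ _ _] := lp.
have gU u : U u -> gram K f u \in unitmx by exact: signature_gram lp.
have fS := local_param_sphere lp.
apply: (parallel_normal_model lp Uu0 (hxi u0 Uu0).1).
apply: (parallel_null_field ambE oU sf gU fS Uu0).
- exact: (nxi.1 [::]).
- by move=> u Uu; exact: (normal_field_normal ambE fS nxi Uu).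
- by move=> u /hxi[].
- by move=> u /hxi[].
Qed.

(** The field xi = h(a, b) stays non-zero near the point by continuity; the argument runs on a ball
    [V] of parameters, while the chart keeps its domain U. *)
Lemma sff_nonzero_model x : sff_nonzero_at n K amb Sigma x -> null_model_at x.
Proof.
move=> [U [f [u0 [a [b [lp Uu0 <- h0]]]]]]; have [oU sf _ _ _] := lp.
have gU u : U u -> gram K f u \in unitmx by exact: signature_gram lp.
have fS := local_param_sphere lp.
pose xi := sff K amb f a b.
have dxi u : U u -> differentiable xi u.
  by move=> Uu; exact: (differentiable_sff ambE oU sf gU fS a b Uu).
have : \forall u \near u0, U u /\ xi u != 0.
  apply: filterI; first exact: open_nbhs_nbhs.
  have := differentiable_continuous (dxi u0 Uu0) => /cvgr_neq0; apply.
  exact/eqP.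
case/nbhs_ballP => r /= r0 hr; pose V := ball u0 r.
have oV : open V by exact: ball_open.
have VU : V `<=` U by move=> u /hr[].
have Vu0 : V u0 by exact: ballxx.
have xi0 u : V u -> null_vector K (xi u).
  by move=> /hr[Uu /eqP xi0]; split => //; exact: nullS lp u Uu a b.
apply: (parallel_normal_model lp Uu0 (xi0 u0 Vu0)).
apply: (parallel_null_field ambE oV
  (smooth_on_sub VU sf) (fun u Vu => gU u (VU u Vu))
  (fun k u Vu => fS k u (VU u Vu)) Vu0).
- by move=> u /VU; exact: dxi.
- by move=> u /VU Uu; exact: (sff_normal ambE oU sf gU fS a b Uu).
- exact: xi0.
(* By polarization h(c, d) is orthogonal to xi(u), hence a multiple of it in the normal plane. *)
move=> u Vu c d; have Uu := VU u Vu.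
apply: (normal_null_line oU sf gU fS Uu (xi0 u Vu)).
- exact: (sff_normal ambE oU sf gU fS a b Uu).
- exact: (sff_normal ambE oU sf gU fS c d Uu).
exact: (isotropic_sff ambE oU sf fS Uu (nullS lp Uu)).
Qed.

(** The signature provides a null normal vector w at u0. Its normal projection is constant on a ball
    and equals w at u0, so w is normal throughout the ball. *)
Lemma totally_geodesic_model U f u0 : local_param Sigma U f -> U u0 ->
  (\forall u \near u0, forall a b, sff K amb f a b u = 0) ->
  null_model_at (f u0).
Proof.
move=> lp Uu0 h0; have [oU sf _ _ _] := lp.
have gU u : U u -> gram K f u \in unitmx by exact: signature_gram lp.
have fS := local_param_sphere lp.
have pn : (p <= n)%N by rewrite sgS.1 leq_addr.
have [w w0 nw] := null_normal_at oU sf fS Uu0 pn (sgS.2 U f lp u0 Uu0).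
apply: (parallel_normal_model lp Uu0 w0).
have : \forall u \near u0, U u /\ forall a b, sff K amb f a b u = 0.
  by apply: filterI => //; exact: open_nbhs_nbhs.
case/nbhs_ballP => r /= r0 hr; apply/nbhs_ballP; exists r; first exact: r0.
move=> u ur.
pose V := ball u0 r; have oV : open V by exact: ball_open.
have VU : V `<=` U by move=> v /hr[].
have D v a : V v -> 'D_a (fun v => nor_part K amb f v w) v = 0.
  apply: (totally_geodesic_nor ambE oV
    (smooth_on_sub VU sf) (fun u Vu => gU u (VU u Vu))
    (fun k u Vu => fS k u (VU u Vu))) => v' /hr[_ h0'] a' b'; exact: h0'.
suff <- : nor_part K amb f u w = w by exact: (nor_normal ambE oU sf gU fS w (VU u ur)).
rewrite -[RHS](nor_id ambE oU sf fS Uu0 nw); apply/rowP => j.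
apply: (derive0_cst_ball (f := fun v => nor_part K amb f v w 0 j)) ur => v Vv a.
have dN : differentiable (fun v => nor_part K amb f v w) v.
  by apply: (differentiable_nor ambE oU sf gU fS (VU v Vv)); exact: differentiable_cst.
split; first by apply: diff_derivable; have /differentiable_mxP := dN; exact.
by rewrite -(derive_coord a 0 j dN) (D v a Vv) mxE.
Qed.

(** Given a neighbourhood B of x and a chart at x, either h is non-zero at some point of the chart
    in B, which is then a model point, or h vanishes near x and x itself is one. *)
Lemma dense_null_model : submanifold n Sigma -> dense_in Sigma null_model_at.
Proof.
move=> subS x Sx B Bx; have [U [f [lp [u0 Uu0 fu0]]]] := subS x Sx.
have [oU sf _ _ _] := lp.
have : \forall u \near u0, U u /\ B (f u).
  apply: filterI; first exact: open_nbhs_nbhs.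
  by apply: (differentiable_continuous (df sf Uu0)); rewrite fu0.
move=> nB; have [[u [Uu Bfu [a [b hab]]]]|none] := pselect (exists u,
    [/\ U u, B (f u) & exists a b, sff K amb f a b u <> 0]).
  exists (f u); split => //; split; first exact: local_param_mem lp Uu.
  by apply: sff_nonzero_model; exists U, f, u, a, b.
exists x; split; last exact: nbhs_singleton Bx.
split => //; rewrite -fu0; apply: (totally_geodesic_model lp Uu0).
near=> u => a b; apply: contrapT => hab; apply: none; exists u.
have [Uu Bu] : U u /\ B (f u) by near: u.
by split => //; exists a, b.
Unshelve. all: by end_near. Qed.

End SpaceForm.

(** * Specialisation to the flat and to the spherical ambient space *)

Lemma flat_ambE (R : realType) n p (x v : 'rV[R]_n.+2) :
  flat_amb x v = v - (false%:R * ip (false + p).+1 v x) *: x.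
Proof. by rewrite mul0r scale0r subr0. Qed.

Lemma sphere_ambE (R : realType) n p (x v : 'rV[R]_n.+3) :
  sphere_amb p.+2 x v = v - (true%:R * ip (true + p).+1 v x) *: x.
Proof. by rewrite mul1r. Qed.

Lemma null_model_flat (R : realType) n p (Sigma : set 'rV[R]_n.+2) x :
  null_model_at (kap := false) p Sigma x -> flat_model_at p.+1 Sigma x.
Proof.
move=> [nu [nunu _ [A [oA Ax AS]]]]; exists nu, x; split => //.
by exists A; split => // y [Sy Ay]; exact: AS.
Qed.

(** As <x, nu> = 0, the affine condition <y - x, nu> = 0 becomes the linear one. *)
Lemma null_model_sphere (R : realType) n p (Sigma : set 'rV[R]_n.+3) x :
  Sigma `<=` unit_sphere n.+3 p.+2 ->
  null_model_at (kap := true) p Sigma x -> sphere_model_at p.+2 Sigma x.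
Proof.
move=> SS [nu [nunu xnu [A [oA Ax AS]]]]; exists nu; split => //.
exists A; split => // y [Sy Ay]; split; last exact: SS.
have := AS y Sy Ay; rewrite mul1r in xnu; rewrite ipBl xnu subr0; exact.
Qed.

Theorem theorem1 (R : realType) (p q n : nat) (n_eq : n = (p + q)%N)
    (n_ge1 : (1 <= n)%N) :
  (* flat case *)
  (forall (nu : 'rV[R]_(n.+2)) (Sigma : set 'rV[R]_(n.+2)),
     null_vector p.+1 nu ->
     submanifold n Sigma ->
     nondegenerate_metric n p.+1 Sigma ->
     Sigma `<=` orth p.+1 nu ->
     [/\ null_sff n p.+1 flat_amb Sigma,
         marginally_trapped n p.+1 flat_amb Sigma,
         flat_tangent_bundle n p.+1 Sigma &
         flat_normal_bundle n p.+1 flat_amb Sigma])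
  /\
  (* spherical case *)
  (forall (nu : 'rV[R]_(n.+3)) (Sigma : set 'rV[R]_(n.+3)),
     null_vector p.+2 nu ->
     submanifold n Sigma ->
     nondegenerate_metric n p.+2 Sigma ->
     Sigma `<=` orth p.+2 nu `&` unit_sphere n.+3 p.+2 ->
     [/\ null_sff n p.+2 (sphere_amb p.+2) Sigma,
         marginally_trapped n p.+2 (sphere_amb p.+2) Sigma,
         constant_scalar_curvature n p.+2 Sigma &
         flat_normal_bundle n p.+2 (sphere_amb p.+2) Sigma])
  /\
  (* converse, flat ambient space *)
  (forall Sigma : set 'rV[R]_(n.+2),
     submanifold n Sigma ->
     has_signature n p.+1 p q Sigma ->
     null_sff n p.+1 flat_amb Sigma ->
     [/\ forall x, Sigma x -> sff_nonzero_at n p.+1 flat_amb Sigma x ->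
           flat_model_at p.+1 Sigma x,
         forall x, Sigma x -> single_null_direction_at n p.+1 flat_amb Sigma x ->
           flat_model_at p.+1 Sigma x &
         dense_in Sigma (flat_model_at p.+1 Sigma)])
  /\
  (* converse, spherical ambient space *)
  (forall Sigma : set 'rV[R]_(n.+3),
     submanifold n Sigma ->
     Sigma `<=` unit_sphere n.+3 p.+2 ->
     has_signature n p.+2 p q Sigma ->
     null_sff n p.+2 (sphere_amb p.+2) Sigma ->
     [/\ forall x, Sigma x -> sff_nonzero_at n p.+2 (sphere_amb p.+2) Sigma x ->
           sphere_model_at p.+2 Sigma x,
         forall x, Sigma x ->
           single_null_direction_at n p.+2 (sphere_amb p.+2) Sigma x ->
           sphere_model_at p.+2 Sigma x &
         dense_in Sigma (sphere_model_at p.+2 Sigma)]).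
Proof.
split; [|split; [|split]].
- move=> nu Sigma nunu _ nd Snu.
  have SS : false -> Sigma `<=` unit_sphere n.+2 p.+1 by [].
  have aE := @flat_ambE R n p.
  split.
  + exact: (hyperplane_null_sff (kap := false) aE SS nunu nd Snu).
  + exact: (hyperplane_marginally_trapped (kap := false) aE SS nunu nd Snu).
  + move=> U f lp u Uu l c i j.
    (* For kap = 0 the right-hand side of the Gauss equation is zero. *)
    rewrite (hyperplane_riemann (kap := false) aE SS nunu nd Snu l c i j lp Uu).
    by rewrite mul0r.
  + exact: (hyperplane_flat_normal_bundle (kap := false) aE SS nunu nd Snu).
- move=> nu Sigma nunu _ nd Snu.
  have SS : true -> Sigma `<=` unit_sphere n.+3 p.+2 by move=> _ x /Snu[].
  have {}Snu : Sigma `<=` orth p.+2 nu by move=> x /Snu[].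
  have aE := @sphere_ambE R n p.
  split.
  + exact: (hyperplane_null_sff (kap := true) aE SS nunu nd Snu).
  + exact: (hyperplane_marginally_trapped (kap := true) aE SS nunu nd Snu).
  + exact: (hyperplane_scalar_curvature (kap := true) aE SS nunu nd Snu).
  + exact: (hyperplane_flat_normal_bundle (kap := true) aE SS nunu nd Snu).
- move=> Sigma subS sg nS.
  have SS : false -> Sigma `<=` unit_sphere n.+2 p.+1 by [].
  have aE := @flat_ambE R n p.
  split=> [x _ hx|x _ hx|x Sx].
  + apply: null_model_flat.
    exact: (sff_nonzero_model (kap := false) aE SS sg nS hx).
  + apply: null_model_flat.
    exact: (single_null_direction_model (kap := false) aE SS sg hx).
  + apply: closure_subset (dense_null_model (kap := false) aE SS sg nS subS Sx).
    by move=> y [Sy My]; split=> //; exact: null_model_flat.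
- move=> Sigma subS S1 sg nS.
  have SS : true -> Sigma `<=` unit_sphere n.+3 p.+2 by [].
  have aE := @sphere_ambE R n p.
  split=> [x _ hx|x _ hx|x Sx].
  + apply: (null_model_sphere S1).
    exact: (sff_nonzero_model (kap := true) aE SS sg nS hx).
  + apply: (null_model_sphere S1).
    exact: (single_null_direction_model (kap := true) aE SS sg hx).
  + apply: closure_subset (dense_null_model (kap := true) aE SS sg nS subS Sx).
    by move=> y [Sy My]; split=> //; exact: (null_model_sphere S1).
Qed.
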